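(* There exist an absolute constant $\epsilon_0>0$ and a function $\eta:(0,\epsilon_0]\to[0,\infty)$ with $\eta(\epsilon)\to0$ as $\epsilon\to0$ such that for every finite set $S\subset\mathbb{R}^2$, every $s\in S$, and every $0<\epsilon\le\epsilon_0$, there is a $\left(1+\epsilon,\ \Bigl(\frac{2\pi}{\sqrt{4\pi^2+1}}+\eta(\epsilon)\Bigr)\cdot\frac1\epsilon\right)$-shallow-light tree for $S$ rooted at $s$ (with respect to the Euclidean metric).
   Context: For a finite point set $S\subset\mathbb{R}^2$, consider the complete graph on $S$ in which each edge $xy$ has weight $w(x,y)=\|x-y\|_2$. For a graph $H$ on $S$, $w(H)$ is the sum of its edge weights, and $\mathrm{dist}_H$ is the weighted shortest-path distance in $H$. Let $\mathrm{MST}(S)$ be a minimum-weight spanning tree of this complete graph. For $\alpha,\beta\ge 1$ and $s\in S$, an $(\alpha,\beta)$-shallow-light tree (SLT) for $S$ rooted at $s$ is a spanning tree $T$ of the complete graph on $S$ (no Steiner points) such that $\mathrm{dist}_T(s,t)\le\alpha\cdot w(s,t)$ for all $t\in S$, and $w(T)\le\beta\cdot w(\mathrm{MST}(S))$. *)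

(* Defs.v *)
From HB Require Import structures.
From mathcomp Require Import all_boot all_order all_algebra finmap.
From mathcomp Require Import all_classical all_reals all_analysis.

Set Implicit Arguments.
Unset Strict Implicit.
Unset Printing Implicit Defensive.

Import Order.TTheory GRing.Theory Num.Theory.
Import numFieldNormedType.Exports.

Local Open Scope classical_set_scope.
Local Open Scope ring_scope.

(* A graph on V is given by its adjacency relation. *)
Section WeightedGraph.
Variables (R : realType) (V : finType) (w : V -> V -> R).
Implicit Types (e T M : rel V) (x y : V) (p : seq V).

Definition simple_graph e : Prop := symmetric e /\ irreflexive e.

(* For a simple graph, the cycles of length at most 2 allowed here are only the
   back-and-forth traversals of single edges. *)
Definition acyclic e : Prop :=
  forall c : seq V, cycle e c -> uniq c -> (size c <= 2)%N.

Definition spanning_tree T : Prop :=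
  [/\ simple_graph T, forall x y, connect T x y & acyclic T].

(* For symmetric e and w, each edge {x, y} occurs twice in the double sum, as
   (x, y) and as (y, x). *)
Definition graph_weight e : R := (\sum_x \sum_(y | e x y) w x y) / 2.

Definition is_MST M : Prop :=
  spanning_tree M /\
  forall T, spanning_tree T -> graph_weight M <= graph_weight T.

Fixpoint walk_weight x p : R :=
  if p is y :: p' then w x y + walk_weight y p' else 0.

(* The value is +oo when no walk joins x to y. *)
Definition graph_dist e x y : \bar R :=
  ereal_inf [set (walk_weight x p)%:E | p in [set p | path e x p /\ last x p = y]].

(* Minimum spanning trees all have the same weight, so the choice of M is
   immaterial. *)
Definition is_SLT (s : V) (alpha beta : R) T : Prop :=
  [/\ 1 <= alpha, 1 <= beta, spanning_tree T,
      forall t, (graph_dist T s t <= (alpha * w s t)%:E)%E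
    & exists M, is_MST M /\ graph_weight T <= beta * graph_weight M].

End WeightedGraph.

(* The library norm on row vectors is the sup norm. *)
Definition edist (R : realType) (x y : 'rV[R]_2) : R :=
  Num.sqrt (\sum_i (x 0 i - y 0 i) ^+ 2).

Definition euclidean_weight (R : realType) (S : {fset 'rV[R]_2}) (x y : S) : R :=
  edist (val x) (val y).
Arguments euclidean_weight {R} S x y.

(* Main.v *)
(** Polar coordinates (r, th) about the root s turn the squared length of a
    segment uv into (r u - r v)^2 + lateral(u, v)^2, where lateral(u, v) is the
    chord of the angle between u and v times sqrt(r u * r v).  From u one
    reaches v with stretch 1 + eps as soon as r u <= r v and the chord is at
    most eps.  Put eps = d^8, root the minimum spanning tree at s, and let W, L
    and B be the total weight of its edges, their total lateral length and their
    total radial length, and Rm the largest radius.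

    Cutting the tree at a random level leaves pieces of relative depth d * eps,
    so that only the tops of the pieces ("representatives"), of total radius
    O(W / (d * eps)), have to be served.  There are two ways to do that.
    - Cut the plane into sectors of angle about eps and annuli of ratio d^2,
      randomly placed; join the lowest representative of each cell to s and the
      others to it.  A cell is paid for by a tree edge entering it, so the
      expected cost is L / eps + O(d W / eps).
    - In each of the 2 pi / eps sectors, run one nearly straight path from s
      through representatives whose radii grow by factors 1 + d^2, and join the
      others to it, at cost 2 pi Rm / eps + O(d W / eps).
    Since W >= sqrt(L^2 + B^2) and B >= Rm, the smaller of L and 2 pi Rm is at
    most 2 pi / sqrt(4 pi^2 + 1) * W. *)

Require Import Defs.
From HB Require Import structures.
From mathcomp Require Import all_boot all_order all_algebra finmap.
From mathcomp Require Import all_classical all_reals all_analysis.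
From mathcomp Require Import ring lra.

Set Implicit Arguments.
Unset Strict Implicit.
Unset Printing Implicit Defensive.

Import Order.TTheory GRing.Theory Num.Theory.
Import numFieldNormedType.Exports.

Local Open Scope classical_set_scope.
Local Open Scope ring_scope.

(** * Parent trees *)

Section Graphs.
Variables (R : realType) (V : finType) (w : V -> V -> R) (s : V).
Hypothesis w_sym : forall x y, w x y = w y x.
Hypothesis w_ge0 : forall x y, 0 <= w x y.

(** [rk] is the number of edges of a shortest walk from [s], and [par v] is the last vertex before
    [v] on such a walk. *)
Lemma bfs_parent (T : rel V) : (forall x y, connect T x y) ->
  exists (par : V -> V) (rk : V -> nat),
    forall v, v != s -> T (par v) v /\ rk v = (rk (par v)).+1.
Proof.
move=> cT.
pose reach v n := `[< exists p, [/\ path T s p, last s p = v & size p = n] >].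
have ex v : exists n, reach v n.
  have /connectP[p pT ->] := cT s v.
  by exists (size p); apply/asboolP; exists p.
pose rk v := ex_minn (ex v).
have step v : exists u, v != s -> T u v /\ rk v = (rk u).+1.
  rewrite {1}/rk; case: ex_minnP => n /asboolP[p [pT lp sp]] nmin.
  case/lastP: p pT lp sp => [_ /= <- _|p x]; first by exists s; rewrite eqxx.
  rewrite rcons_path last_rcons size_rcons => /andP[pT Tx] xv sp.
  exists (last s p) => _; rewrite -xv; split=> //.
  rewrite /rk; case: ex_minnP => m /asboolP[q [qT lq sq]] mmin.
  apply/eqP; rewrite eqn_leq -{2}sp ltnS mmin ?andbT; last first.
    by apply/asboolP; exists p.
  apply: nmin; apply/asboolP; exists (rcons q x).
  by rewrite rcons_path qT lq Tx last_rcons size_rcons sq xv.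
by have [par parP] := choice step; exists par, rk.
Qed.

(** Written over ordered pairs, the sum can be compared term by term with the double sum in
    [graph_weight]. *)
Lemma sum_parent_edges (par : V -> V) : \sum_(v | v != s) w (par v) v =
  \sum_x \sum_y (if (y != s) && (par y == x) then w x y else 0).
Proof.
rewrite exchange_big /= big_mkcond; apply: eq_bigr => y _.
case: (y != s) => /=; last by rewrite big1.
rewrite (bigD1 (par y)) //= eqxx big1 ?addr0 // => x.
by rewrite eq_sym => /negbTE ->.
Qed.

Lemma sum_child_edges (par : V -> V) : \sum_(v | v != s) w (par v) v =
  \sum_x \sum_y (if (x != s) && (par x == y) then w x y else 0).
Proof.
rewrite sum_parent_edges exchange_big /=.
by apply: eq_bigr => y _; apply: eq_bigr => x _; rewrite w_sym.
Qed.

(** Twice the left side counts every parent edge in both orders. No ordered pair is counted twice,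
    since mutual parents would give [rk x = rk x + 2]. *)
Lemma parent_weight_le (T : rel V) (par : V -> V) (rk : V -> nat) :
  symmetric T ->
  (forall v, v != s -> T (par v) v /\ rk v = (rk (par v)).+1) ->
  \sum_(v | v != s) w (par v) v <= graph_weight w T.
Proof.
move=> symT parP.
have E := sum_parent_edges par; have E' := sum_child_edges par.
rewrite /graph_weight ler_pdivlMr // mulr_natr mulr2n {1}E E' -big_split /=.
apply: ler_sum => x _; rewrite -big_split [leRHS]big_mkcond /=.
apply: ler_sum => y _.
have := w_ge0 x y; case: ifPn => [/andP[ys /eqP pyx]|_].
  have [Txy rky] := parP _ ys; rewrite pyx in Txy rky.
  case: ifPn => [/andP[xs /eqP pxy]|_]; last by rewrite Txy addr0.
  have [_] := parP _ xs; rewrite pxy rky => /eqP.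
  by rewrite -addn2 -{1}[rk x]addn0 eqn_add2l.
rewrite add0r; case: ifPn => [/andP[xs /eqP pxy]|_]; last by case: ifP.
by have [] := parP _ xs; rewrite pxy symT => ->.
Qed.

Lemma walk_weight_rcons x p y :
  walk_weight w x (rcons p y) = walk_weight w x p + w (last x p) y.
Proof. by elim: p x => [|z p IH] x /=; rewrite ?addr0 ?add0r // IH addrA. Qed.

(** Since [V] is finite, the order by [D] is well founded: induct on the number of points with a
    smaller value. *)
Lemma potential_ind (D : V -> R) (Q : V -> Prop) :
  (forall v, (forall u, D u < D v -> Q u) -> Q v) -> forall v, Q v.
Proof.
move=> IH v; have [n] := ubnP #|[set u | D u < D v]%SET|.
elim: n v => // n IHn v; rewrite ltnS => vn; apply: IH => u uv; apply: IHn.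
apply: leq_trans vn; apply: proper_card; apply/properP; split.
  by apply/fintype.subsetP => z; rewrite !inE => zu; exact: lt_trans uv.
by exists u; rewrite !inE ?ltxx.
Qed.

Definition parent_tree (par : V -> V) : rel V :=
  fun x y => (y != s) && (par y == x) || (x != s) && (par x == y).

(** * Trees given by a parent map along which a potential decreases *)

Section ParentTree.
Variables (par : V -> V) (D : V -> R).
Hypothesis D_s : D s = 0.
Hypothesis w_par : forall v, v != s -> 0 < w (par v) v.
Hypothesis D_par : forall v, v != s -> D (par v) + w (par v) v <= D v.

Let D_lt v : v != s -> D (par v) < D v.
Proof. by move=> vs; have := w_par vs; have := D_par vs; lra. Qed.

Let T := parent_tree par.

Let T_sym : symmetric T.
Proof. by move=> x y; rewrite /T /parent_tree orbC. Qed.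

Lemma parent_tree_walk v :
  exists p, [/\ path T s p, last s p = v & walk_weight w s p <= D v].
Proof.
elim/(potential_ind (D := D)): v => v IH.
have [->|vs] := eqVneq v s; first by exists [::]; rewrite /= D_s.
have [p [pT lp wp]] := IH _ (D_lt vs).
exists (rcons p v); rewrite rcons_path last_rcons pT lp walk_weight_rcons lp.
split=> //; first by rewrite /T /parent_tree vs eqxx.
by apply: le_trans (D_par vs); rewrite lerD2r.
Qed.

(** For acyclicity, take a vertex of maximal [D] on a cycle of length at least 3: its two neighbours
    there cannot be its children, so both equal its parent, although they are distinct. *)
Lemma parent_tree_spanning : spanning_tree T.
Proof.
split; first split=> // x.
- apply/negbTE; rewrite /T /parent_tree orbb negb_and.
  case: eqVneq => //= xs; apply/eqP => px.
  by have := D_lt xs; rewrite px ltxx.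
- have cs y : connect T s y.
    by have [p [pT <- _]] := parent_tree_walk y; apply/connectP; exists p.
  move=> x y; apply: connect_trans (cs y).
  by rewrite sym_connect_sym.
- move=> c cT cu; rewrite leqNgt; apply/negP => c3.
  have [x0 x0c] : exists x, x \in c.
    by case: c {cT cu} c3 => // x *; exists x; rewrite inE eqxx.
  case: (arg_maxP (fun x : V => D x) x0c) => x xc xmax.
  have adj y : y \in c -> T x y -> y = par x.
    move=> yc /orP[|] /andP[zs /eqP zE] //.
    by have /lt_le_trans/(_ (xmax _ yc)) := D_lt zs; rewrite zE ltxx.
  (* Once the cycle is rotated to start at [x], the neighbours of [x] are its second and last
     entries. *)
  have [i c' cE] := rot_to xc.
  move: cT cu c3; rewrite -(rot_cycle i) -(rot_uniq i) -(size_rot i) cE /=.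
  have memc y : y \in c' -> y \in c.
    by move=> yc; rewrite -(mem_rot i) cE inE yc orbT.
  case: c' cE memc => // a c' _ memc; case/lastP: c' memc => // c' b memc.
  rewrite /= rcons_path last_rcons => /and3P[Txa _ Tbx] /and3P[_ + _] _.
  have ->: a = par x by apply: adj Txa; apply: memc; rewrite inE eqxx.
  have ->: b = par x.
    by apply: adj; [apply: memc; rewrite inE mem_rcons inE eqxx orbT|rewrite T_sym].
  by rewrite mem_rcons inE eqxx.
Qed.

Lemma graph_weight_parent_tree_le :
  graph_weight w T <= \sum_(v | v != s) w (par v) v.
Proof.
have E := sum_parent_edges par; have E' := sum_child_edges par.
rewrite /graph_weight ler_pdivrMr // mulr_natr mulr2n {1}E E' -big_split /=.
apply: ler_sum => x _; rewrite -big_split [leLHS]big_mkcond /=.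
apply: ler_sum => y _; rewrite /T /parent_tree.
have := w_ge0 x y; do 2 case: (_ && _) => //=; rewrite ?addr0 ?add0r //.
by move=> ?; rewrite lerDl.
Qed.

Lemma parent_tree_dist v : (graph_dist w T s v <= (D v)%:E)%E.
Proof.
have [p [pT lp wp]] := parent_tree_walk v.
apply: (@le_trans _ _ (walk_weight w s p)%:E); last by rewrite lee_fin.
by apply: ereal_inf_lbound; exists p.
Qed.

End ParentTree.

Lemma MST_exists : (forall v, v != s -> 0 < w s v) -> exists M, is_MST w M.
Proof.
move=> w_s.
(* The star centred at [s] shows that spanning trees exist. *)
pose T0 := parent_tree (fun _ => s).
have T0s : spanning_tree T0.
  apply: (@parent_tree_spanning _ (fun v => if v == s then 0 else w s v)).
  - by rewrite eqxx.
  - exact: w_s.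
  - by move=> v /negbTE vs; rewrite eqxx vs add0r.
(* Coding relations as sets of pairs puts the minimization on a finite type. *)
pose gr (A : {set V * V}) : rel V := fun x y => (x, y) \in A.
pose enc (T : rel V) : {set V * V} := [set xy | T xy.1 xy.2]%SET.
have encK T : gr (enc T) = T.
  by apply/funext => x; apply/funext => y; rewrite /gr inE.
have P0 : `[< spanning_tree (gr (enc T0)) >] by apply/asboolP; rewrite encK.
case: (arg_minP (P := fun A => `[< spanning_tree (gr A) >])
  (fun A => graph_weight w (gr A)) P0) => A /asboolP As Amin.
exists (gr A); split=> // T Ts; rewrite -(encK T); apply: Amin.
by apply/asboolP; rewrite encK.
Qed.

End Graphs.

(** * Random shifts *)

Section Shift.
Variable R : realType.
Implicit Types x y t : R.

(** By Hermite's identity this is the floor of [m * x]; only its increments matter below. *)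
Let floor_sum (m : nat) x : int := \sum_(k < m) Num.floor (x + k%:R / m%:R).

Let floor_sumD1 m x : (0 < m)%N ->
  floor_sum m (x + 1 / m%:R) = floor_sum m x + 1.
Proof.
case: m => // m _; rewrite /floor_sum big_ord_recr /= [in RHS]big_ord_recl /=.
have -> : x + 1 / m.+1%:R + m%:R / m.+1%:R = x + 1.
  by rewrite -addrA -mulrDl nat1r divff.
rewrite mul0r addr0 floorDrz // floor1 addrA; congr (_ + _).
rewrite addrC; congr (_ + _); apply: eq_bigr => i _; congr Num.floor.
by rewrite -addrA -mulrDl /bump /= nat1r.
Qed.

Let floor_sumD m x n : (0 < m)%N ->
  floor_sum m (x + n%:R / m%:R) = floor_sum m x + n%:R.
Proof.
move=> m0; elim: n => [|n IH]; first by rewrite mul0r !addr0.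
by rewrite -[in LHS]natr1 mulrDl addrA floor_sumD1 // IH -addrA natr1.
Qed.

Let floor_sum_le m x y : (0 < m)%N -> x <= y ->
  (floor_sum m y)%:~R <= (floor_sum m x)%:~R + m%:R * (y - x) + 1 :> R.
Proof.
move=> m0 xy; have m0' : 0 < m%:R :> R by rewrite ltr0n.
have z0 : 0 <= m%:R * (y - x) by apply: mulr_ge0; rewrite ?ler0n ?subr_ge0.
pose n := (Num.trunc (m%:R * (y - x))).+1.
have /andP[nlo nhi] := truncn_itv z0.
have yn : y <= x + n%:R / m%:R.
  rewrite -lerBlDl ler_pdivlMr // mulrC; exact: ltW.
have : floor_sum m y <= floor_sum m x + n%:R.
  rewrite -floor_sumD //; apply: ler_sum => k _; apply: le_floor.
  by rewrite lerD2r.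
rewrite -(ler_int R) intrD => /le_trans; apply.
by rewrite mulrz_nat -addrA lerD2l /n -natr1 lerD2r.
Qed.

(** Every shift that separates [x] from [y] contributes at least 1 to the increment of
    [floor_sum]. *)
Let floor_neq_sum m x y : (0 < m)%N ->
  \sum_(k < m) (Num.floor (x + k%:R / m%:R) != Num.floor (y + k%:R / m%:R))%:R
    <= m%:R * `|x - y| + 1 :> R.
Proof.
move=> m0; wlog xy : x y / x <= y.
  move=> H; have [/H//|/ltW /H] := leP x y; rewrite distrC.
  by apply: le_trans; apply: ler_sum => k _; rewrite eq_sym.
have := floor_sum_le m0 xy; rewrite distrC ger0_norm ?subr_ge0 // -addrA -lerBlDl.
apply: le_trans; rewrite -intrB /floor_sum -sumrB raddf_sum /=.
apply: ler_sum => k _; case: eqVneq => [->|neq]; first by rewrite subrr.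
rewrite ler1z; have : Num.floor (x + k%:R / m%:R) < Num.floor (y + k%:R / m%:R).
  by rewrite lt_neqAle neq le_floor // lerD2r.
by rewrite -subr_gt0 gtz0_ge1.
Qed.

(* The shift is found by averaging over the multiples of a small 1/m. *)
Lemma exists_shift (I : finType) (P : pred I) (c x y : I -> R) (e : R) :
  (forall i, 0 <= c i) -> 0 < e ->
  exists t, \sum_(i | P i && (Num.floor (x i + t) != Num.floor (y i + t))) c i
    <= \sum_(i | P i) c i * (`|x i - y i| + e).
Proof.
(* This makes the error 1/m, incurred by averaging over finitely many shifts, at most [e]. *)
move=> c0 e0; pose m := (Num.trunc e^-1).+1.
have me : 1 / m%:R <= e.
  rewrite ler_pdivrMr ?ltr0n // -ler_pdivrMl // mulr1.
  have e0' : 0 <= e^-1 by rewrite invr_ge0 ltW.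
  by apply/ltW; have /andP[] := truncn_itv e0'.
pose F (k : 'I_m) : R := \sum_(i | P i && (Num.floor (x i + k%:R / m%:R) !=
  Num.floor (y i + k%:R / m%:R))) c i.
set X := \sum_(i | P i) _.
suff FX : \sum_(k < m) F k <= m%:R * X.
  case: (@arg_minP _ _ _ (ord0 : 'I_m) xpredT F isT) => k _ kmin.
  exists (k%:R / m%:R); rewrite -(ler_pM2l (_ : 0 < m%:R)) ?ltr0n //.
  apply: le_trans FX; rewrite -[leLHS]/(m%:R * F k) mulr_natl.
  rewrite -[X in _ *+ X]card_ord -sumr_const.
  by apply: ler_sum => j _; exact: kmin.
rewrite /F; under eq_bigr do rewrite big_mkcondr /=.
rewrite exchange_big mulr_sumr; apply: ler_sum => i _ /=.
rewrite (eq_bigr (fun k : 'I_m => c i * (Num.floor (x i + k%:R / m%:R) !=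
    Num.floor (y i + k%:R / m%:R))%:R)); last first.
  by move=> k _; case: ifP => _; rewrite ?mulr1 ?mulr0.
rewrite -mulr_sumr mulrCA ler_wpM2l //; apply: le_trans (floor_neq_sum _ _ _) _ => //.
rewrite mulrDr lerD2l.
by rewrite -ler_pdivrMl ?ltr0n // mulr1 -[leLHS]mul1r.
Qed.

End Shift.

(** * Trigonometric estimates *)

Section Trigonometry.
Variable R : realType.
Implicit Types x y d k : R.

(** Each Taylor bound for [sin] and [cos] below comes from the preceding one, which is the sign of
    the derivative needed here. *)
Let homo_derive_ge0 (f df : R -> R) :
  (forall x, is_derive x 1 f (df x)) -> (forall x, 0 <= x -> 0 <= df x) ->
  forall x, 0 <= x -> f 0 <= f x.
Proof.
move=> fdf df0 x x0.
have cf : {within `[0, x], continuous f}.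
  apply: continuous_subspaceT => y.
  by apply/differentiable_continuous/derivable1_diffP; have [] := fdf y.
have [c] := MVT_segment x0 (fun y _ => fdf y) cf.
rewrite in_itv /= => /andP[c0 _] fx.
by rewrite -subr_ge0 fx subr0 mulr_ge0 // df0.
Qed.

Let sin_le x : 0 <= x -> sin x <= x.
Proof.
move=> x0.
have D y : is_derive y 1 (fun y => y - sin y) (1 - cos y) by apply: is_derive_eq.
have D0 y : 0 <= y -> 0 <= 1 - cos y by rewrite subr_ge0 cos_le1.
by have := homo_derive_ge0 D D0 x0; rewrite sin0; lra.
Qed.

Lemma cos_ge_quadratic x : 1 - x ^+ 2 / 2 <= cos x.
Proof.
wlog x0 : x / 0 <= x.
  move=> H; have [/H//|/ltW] := leP 0 x; rewrite -oppr_ge0 => /H.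
  by rewrite cosN sqrrN.
have D y : is_derive y 1 (fun y => cos y + y ^+ 2 / 2 - 1) (y - sin y).
  by apply: is_derive_eq; rewrite scaler0 /GRing.scale /=; field.
have D0 y : 0 <= y -> 0 <= y - sin y by rewrite subr_ge0; exact: sin_le.
by have := homo_derive_ge0 D D0 x0; rewrite cos0 expr0n /=; lra.
Qed.

Let sin_ge x : 0 <= x -> x - x ^+ 3 / 6 <= sin x.
Proof.
move=> x0.
have D y : is_derive y 1 (fun y => sin y + y ^+ 3 / 6 - y) (cos y + y ^+ 2 / 2 - 1).
  by apply: is_derive_eq; rewrite scaler0 /GRing.scale /=; field.
have D0 y : 0 <= y -> 0 <= cos y + y ^+ 2 / 2 - 1.
  by have := cos_ge_quadratic y; lra.
by have := homo_derive_ge0 D D0 x0; rewrite sin0 expr0n /=; lra.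
Qed.

Let cos_le_quartic x : cos x <= 1 - x ^+ 2 / 2 + x ^+ 4 / 24.
Proof.
wlog x0 : x / 0 <= x.
  move=> H; have [/H//|/ltW] := leP 0 x; rewrite -oppr_ge0 => /H.
  by rewrite cosN sqrrN (_ : (- x) ^+ 4 = x ^+ 4) //; ring.
have D y : is_derive y 1 (fun y => 1 - y ^+ 2 / 2 + y ^+ 4 / 24 - cos y)
    (sin y + y ^+ 3 / 6 - y).
  by apply: is_derive_eq; rewrite !scaler0 /GRing.scale /=; field.
have D0 y : 0 <= y -> 0 <= sin y + y ^+ 3 / 6 - y.
  by move=> y0; have := sin_ge y0; lra.
by have := homo_derive_ge0 D D0 x0; rewrite cos0 !expr0n /=; lra.
Qed.

Lemma cos_intmul2pi x (j : int) : cos (x + j%:~R * (2 * pi)) = cos x.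
Proof.
have E : (2 * pi : R) = pi *+ 2 by rewrite mulr_natl.
rewrite E mulrC mulrzr; case: j => n; first exact: periodicn (@cosD2pi R) n x.
by rewrite NegzE mulrNz -(periodicn (@cosD2pi R) n.+1 (x - _)) subrK.
Qed.

Lemma exists_angle_representative x :
  exists j : int, `|x + j%:~R * (2 * pi)| <= pi.
Proof.
have p0 : 0 < 2 * pi :> R by rewrite mulr_gt0 // pi_gt0.
pose n := Num.floor ((x + pi) / (2 * pi)).
exists (- n); have /andP[] := floor_itv ((x + pi) / (2 * pi)); rewrite -/n.
rewrite ler_pdivlMr // ltr_pdivrMr // intrD mulrDl mul1r rmorphN /= mulNr => h1 h2.
by rewrite ler_norml; apply/andP; split; lra.
Qed.

(** A short chord forces a small angle: [|d| >= 1] would give [cos d <= 13 / 24], whereas the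
    hypothesis gives [cos d >= 3 / 4]. The quartic bound on [cos] then yields
    [d ^+ 2 <= 3 * k ^+ 2], which makes its fourth-order term negligible. *)
Lemma sqr_angle_le d k : `|d| <= pi -> 0 <= k <= 1 / 2 ->
  2 * (1 - cos d) <= 2 * k ^+ 2 -> d ^+ 2 * (1 - k) <= 2 * (1 - cos d).
Proof.
move=> dpi /andP[k0 k2] hk.
have cosd : cos `|d| = cos d.
  by case: (ler0P d) => // _; rewrite cosN.
have k4 : k ^+ 2 <= 1 / 4 by nra.
have d1 : `|d| < 1.
  rewrite ltNge; apply/negP => d1.
  have p1 : (1 : R) <= pi by have := pi_ge2 R; lra.
  have : cos `|d| <= cos 1.
    move: d1; rewrite le_eqVlt => /orP[/eqP<-//|d1].
    by apply/ltW; rewrite ltr_cos // in_itv /= ?normr_ge0 ?dpi ?ler01 ?p1.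
  rewrite cosd; have := cos_le_quartic 1; rewrite !expr1n => ? ?.
  by lra.
have z1 : d ^+ 2 <= 1 by rewrite -real_normK ?num_real // expr_le1 // ltW.
have z0 : 0 <= d ^+ 2 by rewrite sqr_ge0.
have := cos_le_quartic d; rewrite (_ : d ^+ 4 = (d ^+ 2) ^+ 2); last by rewrite -exprM.
move: (d ^+ 2) z0 z1 (cos d) hk => z z0 z1 c hk hc.
have zz : z ^+ 2 <= z by rewrite expr2 ler_piMr.
have kk : 0 <= k ^+ 2 by rewrite sqr_ge0.
have zk : z <= 3 * k ^+ 2 by lra.
have : z ^+ 2 <= z * (3 * k ^+ 2) by rewrite expr2 ler_wpM2l.
have : z * k ^+ 2 <= z * k.
  by rewrite ler_wpM2l // expr2 ler_piMr //; lra.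
by have := mulr_ge0 z0 k0; lra.
Qed.

End Trigonometry.

(** * Representatives and assembly *)

Section Polar.
Variables (R : realType) (V : finType) (w : V -> V -> R) (s : V) (r th : V -> R).
Hypothesis w_ge0 : forall u v, 0 <= w u v.
Hypothesis w_polar : forall u v, w u v ^+ 2 =
  (r u - r v) ^+ 2 + r u * r v * (2 * (1 - cos (th u - th v))).
Hypothesis r_s : r s = 0.
Hypothesis r_gt0 : forall v, v != s -> 0 < r v.

Let r_ge0 v : 0 <= r v.
Proof. by have [->|/r_gt0/ltW//] := eqVneq v s; rewrite r_s. Qed.

Lemma polar_sym u v : w u v = w v u.
Proof.
apply/eqP; rewrite -(@eqrXn2 _ 2) ?w_ge0 ?r_ge0 // !w_polar; apply/eqP.
by rewrite -opprB sqrrN -[th u - th v]opprB cosN (mulrC (r u)).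
Qed.

Lemma polar_radial_le u v : `|r u - r v| <= w u v.
Proof.
rewrite -ler_sqr ?nnegrE // real_normK ?num_real // w_polar lerDl.
by rewrite !mulr_ge0 // subr_ge0 cos_le1.
Qed.

Lemma polar_root v : w s v = r v.
Proof.
apply/eqP; rewrite -(@eqrXn2 _ 2) ?w_ge0 ?r_ge0 // w_polar r_s; apply/eqP.
by rewrite sub0r sqrrN !mul0r addr0.
Qed.

(** The lateral part is at most [eta * r v], and the hypotenuse is at most the sum of the legs. *)
Lemma polar_link_le u v eta : 0 <= eta ->
  2 * (1 - cos (th u - th v)) <= eta ^+ 2 -> r u <= r v ->
  w u v <= r v - r u + eta * r v.
Proof.
move=> eta0 h uv; have u0 := r_ge0 u; have v0 := r_ge0 v.
have d0 : 0 <= r v - r u by rewrite subr_ge0.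
have e0 : 0 <= eta * r v by rewrite mulr_ge0.
have de0 := addr_ge0 d0 e0.
rewrite -ler_sqr ?nnegrE // w_polar.
have : r u * r v * (2 * (1 - cos (th u - th v))) <= r v * r v * eta ^+ 2.
  by apply: ler_pM => //; rewrite ?mulr_ge0 ?subr_ge0 ?cos_le1 // ler_wpM2r.
by have := mulr_ge0 d0 e0; lra.
Qed.

(** A radius ratio of at least [1 + mu] makes the hop nearly radial:
    [mu * r v <= (1 + mu) * (r v - r u)], so the squared lateral part is at most
    [2 * sig * (r v - r u) ^+ 2], and [1 + 2 * sig <= (1 + sig) ^+ 2]. *)
Lemma polar_hop_le u v eta mu sig : 0 <= mu -> 0 <= sig ->
  2 * (1 - cos (th u - th v)) <= eta ^+ 2 ->
  eta ^+ 2 * (1 + mu) ^+ 2 <= 2 * sig * mu ^+ 2 ->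
  (1 + mu) * r u <= r v -> w u v <= (1 + sig) * (r v - r u).
Proof.
move=> mu0 sig0 h hm uv; have u0 := r_ge0 u; have v0 := r_ge0 v.
have d0 : 0 <= r v - r u by nra.
have sd0 : 0 <= (1 + sig) * (r v - r u) by rewrite mulr_ge0 // addr_ge0.
have md0 : 0 <= (1 + mu) * (r v - r u) by rewrite mulr_ge0 // addr_ge0.
have mv0 : 0 <= mu * r v by rewrite mulr_ge0.
rewrite -ler_sqr ?nnegrE // w_polar.
have h1 : r u * r v * (2 * (1 - cos (th u - th v))) <= r v * r v * eta ^+ 2.
  apply: ler_pM => //; rewrite ?mulr_ge0 ?subr_ge0 ?cos_le1 // ler_wpM2r //.
  by rewrite -subr_ge0.
have h2 : mu * r v <= (1 + mu) * (r v - r u) by nra.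
have h3 : (mu * r v) ^+ 2 <= ((1 + mu) * (r v - r u)) ^+ 2.
  by rewrite ler_sqr ?nnegrE.
have m0 : 0 < (1 + mu) ^+ 2 by rewrite exprn_gt0 // ltr_pwDl.
have h4 : r v ^+ 2 * eta ^+ 2 <= 2 * sig * (r v - r u) ^+ 2.
  rewrite -(ler_pM2r m0).
  apply: (@le_trans _ _ (r v ^+ 2 * (2 * sig * mu ^+ 2))).
    by rewrite -[leLHS]mulrA ler_wpM2l ?sqr_ge0.
  have s20 : 0 <= 2 * sig by rewrite mulr_ge0.
  by have := ler_wpM2l s20 h3; lra.
have : 0 <= sig ^+ 2 * (r v - r u) ^+ 2 by rewrite mulr_ge0 ?sqr_ge0.
lra.
Qed.

Variables (par : V -> V) (rk : V -> nat).
Hypothesis parP : forall v, v != s -> rk v = (rk (par v)).+1.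

Let W := \sum_(v | v != s) w (par v) v.

Lemma radius_le_sum v : r v <= \sum_(u | u != s) `|r (par u) - r u|.
Proof.
(* Restricting to ranks at most [rk v] lets the induction add the term of [v] without having counted
   it before. *)
apply: (@le_trans _ _ (\sum_(u | (u != s) && (rk u <= rk v)%N) `|r (par u) - r u|)).
  have [n] := ubnP (rk v); elim: n v => // n IH v; rewrite ltnS => vn.
  have [->|vs] := eqVneq v s; first by rewrite r_s sumr_ge0.
  have pv : (rk (par v) < rk v)%N by rewrite (parP vs).
  rewrite (bigD1 v) ?vs ?leqnn //=.
  have := IH _ (leq_trans pv vn) => h.
  have : \sum_(u | (u != s) && (rk u <= rk (par v))%N) `|r (par u) - r u| <=
      \sum_(u | (u != s) && (rk u <= rk v)%N && (u != v)) `|r (par u) - r u|.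
    rewrite big_mkcond [leRHS]big_mkcond; apply: ler_sum => u _.
    case: ifPn => [/andP[-> upv]|_]; last by case: ifP.
    rewrite (leq_trans upv (ltnW pv)) (_ : u != v) //.
    by apply: contraTneq upv => ->; rewrite -ltnNge.
  have := ler_norm (r v - r (par v)); rewrite distrC; lra.
rewrite big_mkcond [leRHS]big_mkcond; apply: ler_sum => u _.
by case: (u != s) => //=; case: ifP.
Qed.

Lemma radius_le_weight v : r v <= W.
Proof.
apply: le_trans (radius_le_sum v) _; apply: ler_sum => u _.
exact: polar_radial_le.
Qed.

Let W_ge0 : 0 <= W.
Proof. by apply: sumr_ge0. Qed.

(** This [e] is passed to [exists_shift], whose total averaging error is then at most [W]. *)
Lemma sum_radius_small : exists2 e, 0 < e & \sum_(v | v != s) r v * e <= W.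
Proof.
have n0 : (0 : R) < #|V|.+1%:R by rewrite ltr0n.
exists (#|V|.+1%:R)^-1; first by rewrite invr_gt0.
rewrite -mulr_suml ler_pdivrMr //.
apply: (@le_trans _ _ (\sum_(v | v != s) W)).
  by apply: ler_sum => v _; exact: radius_le_weight.
rewrite sumr_const mulr_natr ler_wpMn2l //.
by apply: leq_trans (leqnSn _); exact: max_card.
Qed.

Lemma exists_depth (g : V -> R) :
  exists lam : V -> R, forall v, v != s -> lam v = lam (par v) + g v.
Proof.
exists (fun v => \sum_(i < rk v) g (iter i par v)) => v vs.
rewrite (parP vs) big_ord_recl /= addrC.
by under eq_bigr do rewrite /bump /= -iterS iterSr.
Qed.

(* Cutting the tree at a random level of the depth in which the edge
   [par v -- v] has length [w (par v) v / r v] costs [W / tau] and leaves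
   pieces of depth less than [tau]. *)
Lemma exists_representatives tau : 0 < tau <= 1 ->
  exists (P : {set V}) (x : V -> R),
    [/\ s \notin P, \sum_(v in P) r v <= W / tau + W,
        forall v, 0 <= x v < tau
      & forall v, v != s -> v \notin P ->
          par v != s /\ x v = x (par v) + w (par v) v / r v].
Proof.
move=> /andP[tau0 tau1].
have [lam lamP] := exists_depth (fun v => w (par v) v / r v).
have [e e0 eW] := sum_radius_small.
have [t tP] := exists_shift (fun v => v != s) (fun v => lam (par v) / tau)
  (fun v => lam v / tau) r_ge0 e0.
pose y v := lam v / tau + t.
(* The representatives are the vertices whose parent edge crosses a level; [x] is [tau] times the
   fractional part of [y], so it grows by the edge length wherever no level is crossed. *)
exists [set v | (v != s) && (Num.floor (y (par v)) != Num.floor (y v))]%SET.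
exists (fun v => tau * (y v - (Num.floor (y v))%:~R)); split.
- by rewrite !inE eqxx.
- rewrite (eq_bigl (fun v => (v != s) && (Num.floor (y (par v)) != Num.floor (y v)))).
  - apply: le_trans tP _.
    under eq_bigr do rewrite mulrDr; rewrite big_split /=; apply: lerD => //.
    rewrite /W mulr_suml; apply: ler_sum => v vs; have rv := r_gt0 vs.
    rewrite distrC -mulrBl (lamP v vs) addrAC subrr add0r ger0_norm; last first.
      by rewrite !divr_ge0 // ltW.
    by rewrite mulrA mulrCA divff ?gt_eqF // mulr1.
  - by move=> v; rewrite inE.
- move=> v; have /andP[h1 h2] := floor_itv (y v).
  apply/andP; split; first by rewrite mulr_ge0 ?subr_ge0 // ltW.
  by rewrite -[ltRHS]mulr1 ltr_pM2l // ltrBlDl -intrD1.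
move=> v vs; rewrite inE vs /= negbK => /eqP yv.
have yE : y v = y (par v) + w (par v) v / r v / tau.
  by rewrite /y (lamP v vs) mulrDl addrAC.
split; last by rewrite -yv yE; field; rewrite !gt_eqF // r_gt0.
(* An edge leaving [s] has relative length 1, which is at least [tau], so it always crosses a
   level. *)
apply/eqP => ps; have /andP[_ hv] := floor_itv (y v).
have /andP[hs _] := floor_itv (y (par v)).
move: hv hs; rewrite yv intrD1 yE ps polar_root divff ?gt_eqF ?r_gt0 // => hv hs.
have : 1 <= 1 / tau by rewrite ler_pdivlMr // mul1r.
by lra.
Qed.

(** * Assembly: representatives hang from hubs, all other vertices keep their parents *)

Section Assembly.
Variables (P Q : {set V}) (x : V -> R) (hp : V -> V) (tau sig eta eps : R).
Hypothesis tau_itv : 0 < tau <= 1 / 4.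
Hypothesis sig_ge0 : 0 <= sig.
Hypothesis eta_ge0 : 0 <= eta.
Hypothesis sP : s \notin P.
Hypothesis x_itv : forall v, 0 <= x v < tau.
Hypothesis xP : forall v, v != s -> v \notin P ->
  par v != s /\ x v = x (par v) + w (par v) v / r v.
(** Interface common to both hub constructions: points of [Q] are reached with stretch [1 + sig] and
    may serve as hubs; the others lose a further [eta] once and serve nobody. *)
Hypothesis hpP : forall v, v \in P ->
  [/\ hp v != v, (hp v == s) || (hp v \in P :&: Q) &
  (1 + sig) * r (hp v) + w (hp v) v <=
    (1 + sig + (if v \in Q then 0 else eta)) * r v].
Hypothesis eps_ge : 1 + sig + eta <= (1 + eps) * (1 - 2 * tau).
Hypothesis w_gt0 : forall u v, u != v -> 0 < w u v.

Let par' v := if v \in P then hp v else par v.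

(* [D] bounds the distance from [s]; the factor [1 / (1 - 2 * x v)] absorbs the
   tree path of relative length [x v] from the representative above [v]. *)
Let D v := if v == s then 0 else if v \in P :&: Q then (1 + sig) * r v
  else (1 + sig + eta) * r v / (1 - 2 * x v).

Let x2_gt0 v : 0 < 1 - 2 * x v.
Proof. by have := x_itv v; move: tau_itv; lra. Qed.

Let D_ge v : v != s -> (1 + sig + eta) * r v <=
  (1 + sig + eta) * r v / (1 - 2 * x v).
Proof.
move=> vs; have r0 := r_gt0 vs; have xv := x2_gt0 v.
have K0 : 0 <= (1 + sig + eta) * r v by rewrite mulr_ge0 ?addr_ge0 // ltW.
rewrite ler_pdivlMr // ler_piMr //.
by have /andP[] := x_itv v; lra.
Qed.

Let D_le v : D v <= (1 + sig + eta) * r v / (1 - 2 * x v).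
Proof.
rewrite /D; case: eqVneq => [->|vs]; first by rewrite r_s mulr0 mul0r.
case: ifP => // _; apply: le_trans (D_ge vs).
by have := mulr_ge0 eta_ge0 (r_ge0 v); lra.
Qed.

Let par'_neq v : v != s -> par' v != v.
Proof.
move=> vs; rewrite /par'; case: ifPn => [/hpP[]//|_].
by apply/eqP => pv; have := parP vs; rewrite pv => /n_Sn.
Qed.

(** Off [P], put [y = w p v / r v]. The bound [r p <= (1 + y) * r v] and the edge itself each cost
    one [y], and [(1 + 2 * y) * (1 - 2 * (x p + y)) <= 1 - 2 * x p]; hence the factor 2 in [D]. *)
Let D_par' v : v != s -> D (par' v) + w (par' v) v <= D v.
Proof.
move=> vs; rewrite /par'; case: ifPn => [vP|vP].
  have [_ hs h] := hpP vP.
  have -> : D (hp v) = (1 + sig) * r (hp v).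
    rewrite /D; case: eqVneq hs => [->|_ /= ->//]; by rewrite r_s mulr0.
  apply: le_trans h _; rewrite /D (negbTE vs) inE vP /=; case: ifP => vQ.
    by rewrite addr0.
  exact: D_ge.
have [ps xv] := xP vs vP.
apply: le_trans (lerD (D_le _) (lexx _)) _.
rewrite /D (negbTE vs) inE (negbTE vP) /=.
set p := par v in ps xv *; have r0 := r_gt0 vs.
pose y := w p v / r v; have wE : w p v = y * r v by rewrite /y divfK // gt_eqF.
have y0 : 0 <= y by rewrite /y divr_ge0 // ltW.
have xp := x2_gt0 p; have xv' := x2_gt0 v; rewrite xv -/y in xv'.
rewrite xv -/y wE.
have rp : r p <= (1 + y) * r v.
  by have := polar_radial_le p v; rewrite wE ler_norml => /andP[_]; lra.
have K1 : 1 <= 1 + sig + eta by rewrite -addrA lerDl addr_ge0.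
move: (1 + sig + eta) K1 => K K1.
have [x0 _] := andP (x_itv p).
have -> : K * r p / (1 - 2 * x p) + y * r v =
    (K * r p + y * r v * (1 - 2 * x p)) / (1 - 2 * x p).
  by field; rewrite gt_eqF.
rewrite ler_pdivrMr // [leRHS]mulrAC ler_pdivlMr //.
have h1 : K * r p + y * r v * (1 - 2 * x p) <= K * r v * (1 + 2 * y).
  apply: (@le_trans _ _ (K * ((1 + y) * r v) + K * (y * r v))); last by lra.
  apply: lerD; first by rewrite ler_wpM2l //; lra.
  have yr : 0 <= y * r v by rewrite mulr_ge0 // ltW.
  apply: (@le_trans _ _ (y * r v)); first by rewrite ler_piMr //; lra.
  by rewrite ler_peMl.
apply: le_trans (ler_wpM2r (ltW xv') h1) _.
have h2 : (1 + 2 * y) * (1 - 2 * (x p + y)) <= 1 - 2 * x p.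
  by have := mulr_ge0 x0 y0; have := mulr_ge0 y0 y0; lra.
have Kr0 : 0 <= K * r v by rewrite mulr_ge0 ?ltW //; lra.
by have := ler_wpM2l Kr0 h2; lra.
Qed.

Lemma assemble_tree : exists T : rel V,
  [/\ spanning_tree T, forall v, (graph_dist w T s v <= ((1 + eps) * r v)%:E)%E
    & graph_weight w T <= \sum_(v in P) w (hp v) v + W].
Proof.
have wp v : v != s -> 0 < w (par' v) v by move=> vs; rewrite w_gt0 // par'_neq.
have Ds : D s = 0 by rewrite /D eqxx.
exists (parent_tree s par'); split.
- exact: (parent_tree_spanning Ds wp D_par').
- move=> v; apply: le_trans (parent_tree_dist Ds wp D_par' v) _.
  rewrite lee_fin; apply: le_trans (D_le _) _.
  rewrite ler_pdivrMr // [leRHS]mulrAC ler_wpM2r //.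
  apply: le_trans eps_ge _; rewrite ler_wpM2l //; last first.
    by have /andP[_ /ltW] := x_itv v; lra.
  have : 0 <= (1 + eps) * (1 - 2 * tau).
    by apply: le_trans eps_ge; rewrite !addr_ge0.
  by rewrite pmulr_lge0 //; move: tau_itv; lra.
apply: le_trans (graph_weight_parent_tree_le s polar_sym w_ge0 _) _.
rewrite (bigID (fun v => v \in P)) /=; apply: lerD.
  rewrite (eq_bigl (fun v => v \in P)) => [|v]; last first.
    by case: eqVneq => //= ->; rewrite (negbTE sP).
  by apply: ler_sum => v vP; rewrite /par' vP.
rewrite /W [leRHS](bigID (fun v => v \in P)) /= ler_wpDl ?sumr_ge0 //.
by apply: ler_sum => v /andP[_ vP]; rewrite /par' (negbTE vP).
Qed.

End Assembly.
End Polar.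

(** * Sectors and spines *)

Section Sectors.
Variables (R : realType) (m : nat).
Implicit Types (a b t : R).

Let M : R := m.+1%:R.

(** The rotation [t] is measured in sector widths. Reducing modulo [m.+1] makes the index depend
    only on the direction of [a]. *)
Definition sector t a : 'I_m.+1 :=
  inord `|(Num.floor (a / (2 * pi / M) + t)%R %% (m.+1 : int))%Z|.

Let M_gt0 : 0 < M. Proof. by rewrite ltr0n. Qed.

Let width_gt0 : 0 < 2 * pi / M.
Proof. by rewrite divr_gt0 // mulr_gt0 // pi_gt0. Qed.

Let sectorE t a b : sector t a = sector t b <->
  (Num.floor (a / (2 * pi / M) + t) ==
   Num.floor (b / (2 * pi / M) + t) %[mod (m.+1 : int)])%Z.
Proof.
have lt (z : int) : (`|(z %% (m.+1 : int))%Z| < m.+1)%N.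
  by rewrite -ltz_nat gez0_abs ?modz_ge0 // ltz_pmod.
split=> [/(congr1 val)|/eqP E]; last by rewrite /sector E.
rewrite /= !inordK // => /(congr1 Posz).
by rewrite !gez0_abs ?modz_ge0 // => ->.
Qed.

(** Up to full turns the two angles differ by at most one sector width, and a chord is no longer
    than its arc. *)
Lemma same_sector_cos t a b : sector t a = sector t b ->
  2 * (1 - cos (a - b)) <= (2 * pi / M) ^+ 2.
Proof.
move=> /sectorE; rewrite eqz_mod_dvd => /dvdzP[k kE].
have d0 := width_gt0.
set d := 2 * pi / M in kE d0 *.
rewrite -(cos_intmul2pi (a - b) (- k)).
have -> : 2 * pi = d * M by rewrite /d divfK // gt_eqF.
have /andP[a1 a2] := floor_itv (a / d + t); have /andP[b1 b2] := floor_itv (b / d + t).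
have := congr1 (fun z : int => z%:~R : R) kE; rewrite intrM intrB /= => kE'.
have E : a - b + (- k)%:~R * (d * M) = d * (a / d + t - (b / d + t) - k%:~R * M).
  by rewrite rmorphN /=; field; rewrite gt_eqF.
have h : `|a / d + t - (b / d + t) - k%:~R * M| <= 1.
  move: a2 b2; rewrite !intrD1 -[M]/((m.+1 : int)%:~R) -kE' ler_norml => a2 b2.
  by apply/andP; split; lra.
have := cos_ge_quadratic (a - b + (- k)%:~R * (d * M)); rewrite E exprMn.
have : (a / d + t - (b / d + t) - k%:~R * M) ^+ 2 <= 1.
  by rewrite -real_normK ?num_real // expr_le1.
move/(ler_wpM2l (sqr_ge0 d)); lra.
Qed.

Lemma sector_intmul2pi t a (j : int) : sector t (a + j%:~R * (2 * pi)) = sector t a.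
Proof.
apply/sectorE; rewrite (_ : _ / _ + t = (a / (2 * pi / M) + t) + (j * (m.+1 : int))%:~R).
  by rewrite floorDrz ?intr_int // intrKfloor addrC modzMDl.
rewrite intrM -[(m.+1 : int)%:~R]/M.
move: (pi : R) (pi_gt0 R) M M_gt0 => p p0 N N0.
by field; rewrite !gt_eqF.
Qed.

End Sectors.

(** * Greedy spines, one in each sector *)

Section Spine.
Variables (R : realType) (V : finType) (w : V -> V -> R) (s : V) (r th : V -> R).
Hypothesis w_ge0 : forall u v, 0 <= w u v.
Hypothesis w_polar : forall u v, w u v ^+ 2 =
  (r u - r v) ^+ 2 + r u * r v * (2 * (1 - cos (th u - th v))).
Hypothesis r_s : r s = 0.
Hypothesis r_gt0 : forall v, v != s -> 0 < r v.
Variables (eta mu sig Rmax : R).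
Hypothesis eta_ge0 : 0 <= eta.
Hypothesis mu_ge0 : 0 <= mu.
Hypothesis sig_ge0 : 0 <= sig.
Hypothesis hop_ok : eta ^+ 2 * (1 + mu) ^+ 2 <= 2 * sig * mu ^+ 2.
Hypothesis r_max : forall v, r v <= Rmax.

Let r_ge0 v : 0 <= r v.
Proof. by have [->|/r_gt0/ltW//] := eqVneq v s; rewrite r_s. Qed.

Let sig1_ge0 : 0 <= 1 + sig. Proof. by rewrite addr_ge0. Qed.
Let mueta_ge0 : 0 <= mu + eta. Proof. by rewrite addr_ge0. Qed.

Let close u v := 2 * (1 - cos (th u - th v)) <= eta ^+ 2.

(* The invariant [u] is the last hub placed so far: the next point becomes a
   hub exactly when it is farther than [u] by a factor [1 + mu]. *)
Lemma greedy_spine (l : seq V) (u : V) :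
  sorted (fun a b => r a <= r b) l -> uniq l -> u \notin l ->
  (forall x, x \in l -> r u <= r x) ->
  (forall x, x \in l -> u != s -> close u x) ->
  (forall x y, x \in l -> y \in l -> close x y) ->
  exists (hp : V -> V) (Q : pred V),
    (forall x, x \in l ->
       [/\ hp x != x, (hp x == u) || (hp x \in l) && Q (hp x) &
           (1 + sig) * r (hp x) + w (hp x) x <=
             (1 + sig + (if Q x then 0 else eta)) * r x]) /\
    \sum_(x <- l) w (hp x) x <=
      (1 + sig) * (Rmax - r u) + (mu + eta) * \sum_(x <- l) r x.
Proof.
elim: l u => [|x l IH] u.
  move=> _ _ _ _ _ _; exists id, predT; split=> //.
  by rewrite !big_nil mulr0 addr0 mulr_ge0 // subr_ge0.
move=> sl /= /andP[xl ul]; rewrite inE negb_or => /andP[ux unl] rul cul cl.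
have sl' : sorted (fun a b => r a <= r b) l by apply: path_sorted sl.
have rxl y : y \in l -> r x <= r y.
  move: sl; rewrite /= path_sortedE => [|a b c]; last exact: le_trans.
  by move=> /andP[/allP h _] /h.
have rux := rul x (mem_head _ _).
have cl' y z : y \in l -> z \in l -> close y z.
  by move=> yl zl; apply: cl; rewrite inE ?yl ?zl orbT.
have neq y : y \in l -> (y == x) = false.
  by move=> yl; apply: contraNF xl => /eqP <-.
have rx0 := r_ge0 x; have ru0 := r_ge0 u.
have [hub|] := boolP ((u == s) || ((1 + mu) * r u <= r x)).
  have wux : w u x <= (1 + sig) * (r x - r u).
    have [us|us] := eqVneq u s.
      rewrite us (polar_root w_ge0 w_polar r_s r_gt0) r_s subr0.
      by rewrite ler_peMl // lerDl.
    apply: (polar_hop_le w_ge0 w_polar r_s r_gt0 mu_ge0 sig_ge0 _ hop_ok).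
      exact: cul (mem_head _ _) us.
    by move: hub; rewrite (negbTE us).
  have [y yl _|hp [Q [hpP hpw]]] := IH x sl' ul xl rxl _ cl'.
    by apply: cl; rewrite inE ?eqxx ?yl ?orbT.
  (* The spine edge costs at most [(1 + sig) * (r x - r u)]; these costs telescope to the first term
     of the bound. *)
  exists (fun y => if y == x then u else hp y), (fun y => (y == x) || Q y).
  split=> [y|].
    rewrite inE => /orP[/eqP->|yl].
      rewrite eqxx /= eqxx orTb addr0; split=> //; lra.
    rewrite (neq _ yl) /=; have [h1 h2 h3] := hpP y yl; split=> //.
    case/orP: h2 => [/eqP->|/andP[hl hQ]]; first by rewrite eqxx inE eqxx !orbT.
    by rewrite inE hl hQ !orbT.
  rewrite !big_cons eqxx.
  rewrite (eq_big_seq (fun y => w (hp y) y)) => [|y yl]; last by rewrite neq.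
  have : 0 <= (mu + eta) * r x by rewrite mulr_ge0.
  lra.
rewrite negb_or -ltNge => /andP[us rxu].
(* Here [r x - r u < mu * r u <= mu * r x], so the link is paid for by [(mu + eta) * r x]. *)
have wux := polar_link_le w_ge0 w_polar r_s r_gt0 eta_ge0 (cul x (mem_head _ _) us) rux.
have [y yl|y yl|hp [Q [hpP hpw]]] := IH u sl' ul unl _ _ cl'.
- by apply: rul; rewrite inE yl orbT.
- by apply: cul; rewrite inE yl orbT.
exists (fun y => if y == x then u else hp y), (fun y => (y != x) && Q y).
split=> [y|].
  rewrite inE => /orP[/eqP->|yl].
    rewrite eqxx /= eqxx orTb; split=> //.
    by have := ler_wpM2l sig_ge0 rux; lra.
  rewrite (neq _ yl) /=; have [h1 h2 h3] := hpP y yl; split=> //.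
  case/orP: h2 => [/eqP->|/andP[hl hQ]]; first by rewrite eqxx.
  by rewrite inE hl hQ neq // !orbT.
rewrite !big_cons eqxx.
rewrite (eq_big_seq (fun y => w (hp y) y)) => [|y yl]; last by rewrite neq.
by have := ler_wpM2l mu_ge0 rux; lra.
Qed.

(** Apply [greedy_spine] from [s] to the points of [P] in each sector, sorted by radius, and glue:
    each point uses the map of its own sector. *)
Lemma spines (m : nat) (P : {set V}) : s \notin P -> eta = 2 * pi / m.+1%:R ->
  exists (hp : V -> V) (Q : {set V}),
    (forall v, v \in P ->
       [/\ hp v != v, (hp v == s) || (hp v \in P :&: Q) &
           (1 + sig) * r (hp v) + w (hp v) v <=
             (1 + sig + (if v \in Q then 0 else eta)) * r v]) /\
    \sum_(v in P) w (hp v) v <=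
      m.+1%:R * ((1 + sig) * Rmax) + (mu + eta) * \sum_(v in P) r v.
Proof.
move=> sP etaE.
pose sec v := sector m 0 (th v).
pose l i := sort (fun a b => r a <= r b) [seq v <- enum P | sec v == i].
have lE i v : (v \in l i) = (sec v == i) && (v \in P).
  by rewrite mem_sort mem_filter mem_enum.
have /choice[hp hpP] (i : 'I_m.+1) : exists hpQ : (V -> V) * pred V,
   (forall x, x \in l i ->
       [/\ hpQ.1 x != x, (hpQ.1 x == s) || (hpQ.1 x \in l i) && hpQ.2 (hpQ.1 x) &
           (1 + sig) * r (hpQ.1 x) + w (hpQ.1 x) x <=
             (1 + sig + (if hpQ.2 x then 0 else eta)) * r x]) /\
    \sum_(x <- l i) w (hpQ.1 x) x <=
      (1 + sig) * (Rmax - r s) + (mu + eta) * \sum_(x <- l i) r x.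
  have [||||||hp [Q H]] := @greedy_spine (l i) s.
  - by apply: sort_sorted => a b; exact: le_total.
  - by rewrite sort_uniq filter_uniq // enum_uniq.
  - by rewrite lE (negbTE sP) andbF.
  - by move=> x _; rewrite r_s.
  - by move=> x _; rewrite eqxx.
  - move=> x y; rewrite !lE => /andP[/eqP xi _] /andP[/eqP yi _].
    by rewrite /close etaE; apply: (@same_sector_cos _ m 0); rewrite -/(sec x) xi.
  by exists (hp, Q).
exists (fun v => (hp (sec v)).1 v), [set v | (hp (sec v)).2 v]%SET; split=> [v vP|].
  have [h _] := hpP (sec v); have vl : v \in l (sec v) by rewrite lE eqxx.
  have [h1 h2 h3] := h v vl; rewrite !inE; split=> //.
  case/orP: h2 => [->//|]; rewrite lE => /andP[/andP[/eqP e ->]].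
  by rewrite e => ->; rewrite orbT.
have split_sec (f : V -> R) : \sum_(v in P) f v = \sum_i \sum_(x <- l i) f x.
  rewrite (partition_big sec xpredT) //=; apply: eq_bigr => i _.
  rewrite (perm_big _ (permEl (perm_sort _ _))) /= big_filter big_enum_cond /=.
  by apply: eq_bigl => v.
rewrite !split_sec mulr_sumr -[m.+1%:R](_ : \sum_(i < m.+1) 1 = _); last first.
  by rewrite sumr_const card_ord.
rewrite mulr_suml -big_split /=; apply: ler_sum => i _.
rewrite mul1r; have [_] := hpP i; rewrite r_s subr0.
apply: le_trans; rewrite le_eqVlt; apply/orP; left; apply/eqP.
by apply: eq_big_seq => x; rewrite lE => /andP[/eqP->].
Qed.

End Spine.

(** * Random cells *)

Section Cells.
Variables (R : realType) (V : finType) (s : V) (r : V -> R).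
Hypothesis r_ge0 : forall v, 0 <= r v.
Variables (par : V -> V) (rk : V -> nat).
Hypothesis parP : forall v, v != s -> rk v = (rk (par v)).+1.
Variables (C : eqType) (cell : V -> C) (P : {set V}) (k : R).
Hypothesis sP : s \notin P.
Hypothesis k_ge0 : 0 <= k.
Hypothesis cell_r : forall u v, u != s -> v != s -> cell u = cell v -> r u <= k * r v.

(** The choice depends on the cell alone, so all representatives in a cell share one hub. *)
Let lowest (c : C) : option V :=
  [pick u in P | (cell u == c) && [forall x in P, (cell x == c) ==> (r u <= r x)]].

(* Each hub is charged to the vertex of its cell nearest to the root in the
   tree: the edge from that vertex to its parent leaves the cell. *)
Lemma cell_hubs : exists hub : V -> V,
  (forall v, v \in P -> [/\ hub v \in P, cell (hub v) = cell v,
     r (hub v) <= r v & hub (hub v) = hub v]) /\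
  \sum_(v in P | hub v == v) r v <=
    k * \sum_(v | (v != s) && ((par v == s) || (cell (par v) != cell v))) r v.
Proof.
pose hub v := odflt v (lowest (cell v)).
have hubP v : v \in P -> [/\ hub v \in P, cell (hub v) = cell v, r (hub v) <= r v
    & lowest (cell v) = Some (hub v)].
  move=> vP; rewrite /hub /lowest; case: pickP => [u /and3P[uP /eqP uv]|none] /=.
    by move=> /'forall_implyP/(_ v vP); rewrite eqxx.
  have v0 : (v \in P) && (cell v == cell v) by rewrite vP eqxx.
  case: (arg_minP (P := fun u => (u \in P) && (cell u == cell v)) r v0).
  move=> u /andP[uP uv] umin; have := none u; rewrite uP uv /=.
  move=> /negP[]; apply/'forall_implyP => x xP; apply/implyP => xv.
  by apply: umin; rewrite xP xv.
exists hub; split=> [v vP|].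
  have [h1 h2 h3 h4] := hubP v vP; split=> //.
  by have [_ _ _ h5] := hubP _ h1; apply: Some_inj; rewrite -h5 h2.
(* [top q] ranges over all vertices of the cell, not only over [P]; its parent has smaller rank,
   hence is [s] or lies outside the cell. *)
pose top q := [arg min_(v < q | (v != s) && (cell v == cell q)) rk v].
have topP q : q \in P -> [/\ top q != s, cell (top q) = cell q &
    forall v, v != s -> cell v = cell q -> (rk (top q) <= rk v)%N].
  move=> qP; have qs : (q != s) && (cell q == cell q).
    by rewrite eqxx andbT; apply: contraNneq sP => <-.
  rewrite /top; case: arg_minnP => // v /andP[vs /eqP vq] vmin; split=> // u us uq.
  by apply: vmin; rewrite us uq eqxx.
pose Q := [set v in P | hub v == v]%SET.
(* Distinct hubs lie in distinct cells, so no edge is charged twice. *)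
have topI : {in Q &, injective top}.
  move=> p q; rewrite !inE => /andP[pP /eqP hp] /andP[qP /eqP hq] pq.
  have [_ _ _ lp] := hubP p pP; have [_ _ _ lq] := hubP q qP.
  have [_ cp _] := topP p pP; have [_ cq _] := topP q qP.
  by rewrite -hp -hq; apply: Some_inj; rewrite -lp -lq -cp -cq pq.
apply: (@le_trans _ _ (\sum_(v in Q) k * r (top v))).
  rewrite (eq_bigl (fun v => v \in Q)) => [|v]; last by rewrite inE.
  apply: ler_sum => q; rewrite inE => /andP[qP _].
  have [ts tq _] := topP q qP; apply: cell_r => //.
  by apply: contraNneq sP => <-.
rewrite -mulr_sumr ler_wpM2l // -(big_imset r topI) /= big_mkcond [leRHS]big_mkcond.
apply: ler_sum => v _; case: ifPn => [/imsetP[q]|_]; last by case: ifP.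
rewrite inE => /andP[qP _] ->; have [-> tq tmin] := topP q qP.
rewrite /= (_ : (_ == s) || _) //.
have [//|ps /=] := eqVneq (par (top q)) s.
apply/eqP => e; have := tmin _ ps; rewrite e => /(_ tq).
by rewrite leqNgt (parP (v := top q)) ?ltnS ?leqnn //; have [] := topP q qP.
Qed.

End Cells.

(** * Randomly placed polar cells and the cost of their hubs *)

Section RandomCells.
Variables (R : realType) (V : finType) (w : V -> V -> R) (s : V) (r th : V -> R).
Hypothesis w_ge0 : forall u v, 0 <= w u v.
Hypothesis w_polar : forall u v, w u v ^+ 2 =
  (r u - r v) ^+ 2 + r u * r v * (2 * (1 - cos (th u - th v))).
Hypothesis r_s : r s = 0.
Hypothesis r_gt0 : forall v, v != s -> 0 < r v.
Variables (par : V -> V) (rk : V -> nat).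
Hypothesis parP : forall v, v != s -> rk v = (rk (par v)).+1.
Variables (m : nat) (kap : R).
Hypothesis kap_itv : 0 < kap <= 1 / 2.

Let r_ge0 v : 0 <= r v.
Proof. by have [->|/r_gt0/ltW//] := eqVneq v s; rewrite r_s. Qed.

Let ln_diff_le a b : 0 < a -> 0 < b -> ln a - ln b <= (a - b) / b :> R.
Proof.
move=> a0 b0; rewrite -ln_div ?posrE //.
have -> : a / b = 1 + (a - b) / b by rewrite mulrBl divff ?gt_eqF // addrC subrK.
by apply: le_ln1Dx; rewrite ltr_pdivlMr // mulN1r ltrBrDr addNr.
Qed.

Definition lateral u v := Num.sqrt (r u * r v * (2 * (1 - cos (th u - th v)))).

(** Radii are cut on a logarithmic scale, so the chance that an edge crosses an annulus boundary is
    governed by its relative radial change. *)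
Definition polar_cell (t1 t2 : R) v : int * 'I_m.+1 :=
  (Num.floor (ln (r v) / kap + t1), sector m t2 (th v)).

Let W := \sum_(v | v != s) w (par v) v.
Let L := \sum_(v | v != s) lateral (par v) v.
Let eta : R := 2 * pi / m.+1%:R.

Lemma polar_cell_radius t1 t2 u v : u != s -> v != s ->
  polar_cell t1 t2 u = polar_cell t1 t2 v -> r u <= (1 - kap)^-1 * r v.
Proof.
move=> us vs [e _]; have [k0 k1] := andP kap_itv.
have u0 := r_gt0 us; have v0 := r_gt0 vs.
have /andP[_ h1] := floor_itv (ln (r u) / kap + t1).
have /andP[h2 _] := floor_itv (ln (r v) / kap + t1).
rewrite e intrD1 in h1.
have h3 : ln (r u) / kap - ln (r v) / kap <= 1 by lra.
move: h3; rewrite -mulrBl ler_pdivrMr // mul1r => h3.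
have := ln_diff_le v0 u0; rewrite ler_pdivlMr // => h4.
rewrite mulrC ler_pdivlMr; last by lra.
have : kap * r u >= (ln (r u) - ln (r v)) * r u by rewrite ler_wpM2r // ltW.
lra.
Qed.

(** An edge that is not short satisfies [r v <= w (par v) v / kap] and pays for itself. Along a
    short one the two radii are comparable, which the crossing estimates need. *)
Let short v := (v != s) && (w (par v) v < kap * r v).

Let short_par v : short v -> [/\ 0 < r v, 0 < r (par v) & (1 - kap) * r v <= r (par v)].
Proof.
move=> /andP[vs wv]; have [k0 k1] := andP kap_itv; have v0 := r_gt0 vs.
have h : (1 - kap) * r v <= r (par v).
  have := polar_radial_le w_ge0 w_polar r_s r_gt0 (par v) v.
  by rewrite ler_norml => /andP[+ _]; lra.
split=> //; apply: lt_le_trans h; rewrite mulr_gt0 //; lra.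
Qed.

Let short_radial v : short v ->
  r v * `|ln (r (par v)) / kap - ln (r v) / kap| <= 2 * w (par v) v / kap.
Proof.
move=> sv; have [v0 p0 hp] := short_par sv; have [k0 k1] := andP kap_itv.
have ki0 : 0 <= kap^-1 by rewrite invr_ge0 ltW.
rewrite -mulrBl normrM [ `|kap^-1| ]ger0_norm // mulrA.
rewrite ler_pM2r ?invr_gt0 //.
have := polar_radial_le w_ge0 w_polar r_s r_gt0 (par v) v.
rewrite ler_norml => /andP[h1 h2]; have w0 := w_ge0 (par v) v.
have := ln_diff_le p0 v0; have := ln_diff_le v0 p0.
rewrite !ler_pdivlMr // => h3 h4.
have h5 : r v <= 2 * r (par v).
  have : (1 / 2) * r v <= (1 - kap) * r v by apply: ler_wpM2r; [exact: ltW|lra].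
  lra.
have [h|/ltW h] := leP (ln (r v)) (ln (r (par v))).
  by rewrite ger0_norm ?subr_ge0 //; lra.
rewrite ler0_norm ?subr_le0 // opprB.
have : (ln (r v) - ln (r (par v))) * r v <= (ln (r v) - ln (r (par v))) * (2 * r (par v)).
  by rewrite ler_wpM2l // subr_ge0.
lra.
Qed.

(** Shortness bounds the chord well enough for [sqr_angle_le] with [k = kap]. After squaring, one
    factor [1 - kap] comes from there and the other from [(1 - kap) * r v <= r (par v)]. *)
Let short_angular v d : short v -> `|d| <= pi -> cos d = cos (th (par v) - th v) ->
  r v * `|d| <= lateral (par v) v / (1 - kap).
Proof.
move=> sv dpi cosd; have [v0 p0 hp] := short_par sv; have [k0 k1] := andP kap_itv.
have [vs wv] := andP sv.
have k' : 0 < 1 - kap by lra.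
have rd0 : 0 <= r v * `|d| * (1 - kap).
  by apply: mulr_ge0; [apply: mulr_ge0 => //; exact: ltW|exact: ltW].
rewrite ler_pdivlMr // -ler_sqr ?nnegrE ?sqrtr_ge0 //.
rewrite /lateral -cosd; set c := 2 * (1 - cos d).
have c0 : 0 <= c by rewrite mulr_ge0 // subr_ge0 cos_le1.
have pv0 : 0 <= r (par v) * r v by rewrite mulr_ge0 // ltW.
rewrite sqr_sqrtr; last by rewrite mulr_ge0.
have kv0 : 0 <= kap * r v by rewrite mulr_ge0 // ltW.
have hw : r (par v) * r v * c <= (kap * r v) ^+ 2.
  apply: (@le_trans _ _ (w (par v) v ^+ 2)).
    by rewrite w_polar -cosd -/c lerDr sqr_ge0.
  by rewrite ler_sqr ?nnegrE // ltW.
have hc : c <= 2 * kap ^+ 2.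
  have v20 : 0 < r v ^+ 2 by rewrite exprn_gt0.
  rewrite -(ler_pM2l v20).
  have : (1 / 2 * r v) * r v * c <= r (par v) * r v * c.
    apply: ler_wpM2r => //; apply: ler_wpM2r; first exact: ltW.
    by apply: le_trans hp; apply: ler_wpM2r; [exact: ltW|lra].
  lra.
have kap2 : 0 <= kap <= 1 / 2 by rewrite ltW.
have := sqr_angle_le dpi kap2 hc; rewrite -/c => hd.
have h1 : (1 - kap) * r v * (r v * c) <= r (par v) * (r v * c).
  by rewrite ler_wpM2r // mulr_ge0 // ltW.
have h2 : (1 - kap) * r v ^+ 2 * (d ^+ 2 * (1 - kap)) <= (1 - kap) * r v ^+ 2 * c.
  by rewrite ler_wpM2l // mulr_ge0 ?sqr_ge0 // ltW.
have : `|d| ^+ 2 = d ^+ 2 by rewrite real_normK ?num_real.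
rewrite !exprMn => ->; lra.
Qed.

Let short_sum (f g : V -> R) : (forall v, short v -> f v <= g v) ->
  (forall v, 0 <= g v) -> \sum_(v | short v) f v <= \sum_(v | v != s) g v.
Proof.
move=> fg g0; rewrite big_mkcond [leRHS]big_mkcond; apply: ler_sum => v _.
by case: ifPn => [sv|_]; [have [-> _] := andP sv; exact: fg|case: ifP].
Qed.

(** A crossing edge is long ([W / kap]), or changes annulus ([2 * W / kap + W]), or changes sector
    ([L / (1 - kap) / eta + W]). The two shifts are chosen separately; each single [W] is an
    averaging error. *)
Lemma exists_cell_shift : exists t1 t2,
  \sum_(v | (v != s) &&
    ((par v == s) || (polar_cell t1 t2 (par v) != polar_cell t1 t2 v))) r v
    <= 3 * W / kap + 2 * W + L / (1 - kap) / eta.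
Proof.
have [k0 k1] := andP kap_itv.
have eta0 : 0 < eta by rewrite divr_gt0 ?mulr_gt0 ?pi_gt0 ?ltr0n.
have [e e0 eW] := sum_radius_small w_ge0 w_polar r_s r_gt0 parP.
have [t1 t1P] := exists_shift short (fun v => ln (r (par v)) / kap)
  (fun v => ln (r v) / kap) r_ge0 e0.
(* Full turns bring the angle of [par v] within [pi] of that of [v]; they do not change its
   sector. *)
have /choice[j jP] v := exists_angle_representative (th (par v) - th v).
have [t2 t2P] := exists_shift short (fun v => (th (par v) + (j v)%:~R * (2 * pi)) / eta)
  (fun v => th v / eta) r_ge0 e0.
exists t1, t2.
have lat0 v : 0 <= lateral (par v) v by exact: sqrtr_ge0.
have k' : 0 < 1 - kap by lra.
have H1 : \sum_(v | (v != s) && ~~ short v) r v <= W / kap.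
  rewrite /W mulr_suml big_mkcondr; apply: ler_sum => v vs.
  case: ifPn => [|_]; last by rewrite divr_ge0 // ltW.
  by rewrite /short vs /= -leNgt ler_pdivlMr // mulrC.
have H2 := le_trans t1P (short_sum
  (g := fun v => 2 * w (par v) v / kap + r v * e) _ _).
have H3 := le_trans t2P (short_sum
  (g := fun v => lateral (par v) v / (1 - kap) / eta + r v * e) _ _).
have {}H2 : \sum_(v | short v && (Num.floor (ln (r (par v)) / kap + t1) !=
    Num.floor (ln (r v) / kap + t1))) r v <= 2 * W / kap + W.
  apply: le_trans (H2 _ _) _ => [v sv|v|].
  - by rewrite mulrDr lerD2r; exact: short_radial.
  - by rewrite addr_ge0 ?divr_ge0 ?mulr_ge0 // ltW.
  rewrite big_split /=; apply: lerD => //.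
  by rewrite /W mulr_sumr mulr_suml.
have {}H3 : \sum_(v | short v &&
   (Num.floor ((th (par v) + (j v)%:~R * (2 * pi)) / eta + t2) !=
    Num.floor (th v / eta + t2))) r v <= L / (1 - kap) / eta + W.
  apply: le_trans (H3 _ _) _ => [v sv|v|].
  - have ei0 : 0 <= eta^-1 by rewrite invr_ge0 ltW.
    rewrite mulrDr lerD2r -mulrBl normrM [ `|eta^-1| ]ger0_norm //.
    rewrite mulrA ler_pM2r ?invr_gt0 //; apply: short_angular => //.
      by rewrite addrAC; exact: jP.
    by rewrite addrAC cos_intmul2pi.
  - apply: addr_ge0; last by rewrite mulr_ge0 // ltW.
    by apply: divr_ge0; [apply: divr_ge0 => //|]; exact: ltW.
  rewrite big_split /=; apply: lerD => //.
  by rewrite /L !mulr_suml.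
apply: (@le_trans _ _
  (W / kap + (2 * W / kap + W) + (L / (1 - kap) / eta + W))); last by lra.
apply: le_trans (lerD (lerD H1 H2) H3).
rewrite big_mkcond [X in _ <= X + _ + _]big_mkcond [X in _ <= _ + X + _]big_mkcond.
rewrite [X in _ <= _ + _ + X]big_mkcond -!big_split; apply: ler_sum => v _ /=.
have rv := r_ge0 v.
have ite0 (b : bool) : 0 <= (if b then r v else 0) by case: b.
case: ifPn => [/andP[vs crossing]|_]; last by rewrite !addr_ge0.
rewrite vs; case: (boolP (short v)) => [sv|_] /=; last by rewrite -addrA lerDl addr_ge0.
have [_ p0 _] := short_par sv.
rewrite add0r; move: crossing; case: eqVneq => [ps|_ /=].
  by move: p0; rewrite ps r_s ltxx.
rewrite /polar_cell xpair_eqE negb_and => /orP[->|sec]; first by rewrite lerDl.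
rewrite [X in _ + X]ifT; first by rewrite lerDr.
apply: contra sec => /eqP fl; rewrite -(sector_intmul2pi m t2 (th (par v)) (j v)).
by rewrite /sector fl.
Qed.

(** Hubs are joined straight to [s] and form [Q]. Any other point shares an annulus and a sector
    with its hub, so its link costs at most [(kap + eta) * r v]. *)
Lemma cell_spokes (P : {set V}) (sig : R) : s \notin P -> 0 <= sig ->
  exists (hp : V -> V) (Q : {set V}),
    (forall v, v \in P ->
       [/\ hp v != v, (hp v == s) || (hp v \in P :&: Q) &
           (1 + sig) * r (hp v) + w (hp v) v <=
             (1 + sig + (if v \in Q then 0 else eta)) * r v]) /\
    \sum_(v in P) w (hp v) v <=
      (3 * W / kap + 2 * W + L / (1 - kap) / eta) / (1 - kap)
      + (kap + eta) * \sum_(v in P) r v.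
Proof.
move=> sP sig0; have [k0 k1] := andP kap_itv; have k' : 0 < 1 - kap by lra.
have eta0 : 0 <= eta by rewrite divr_ge0 ?mulr_ge0 ?pi_ge0.
have [t1 [t2 tP]] := exists_cell_shift.
have ki0 : 0 <= (1 - kap)^-1 by rewrite invr_ge0 ltW.
have [hub [hubP hub_sum]] := cell_hubs r_ge0 parP sP ki0 (@polar_cell_radius t1 t2).
have Ps v : v \in P -> v != s by move=> vP; apply: contraNneq sP => <-.
have link v : v \in P -> w (hub v) v <= r v - r (hub v) + eta * r v.
  move=> vP; have [hP [_ hs] hr _] := hubP v vP.
  apply: (polar_link_le w_ge0 w_polar r_s r_gt0) => //.
  exact: same_sector_cos hs.
exists (fun v => if hub v == v then s else hub v), [set v | hub v == v]%SET.
split=> [v vP|].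
  have [hP _ hr hh] := hubP v vP; rewrite inE.
  case: (boolP (hub v == v)) => [_|hv].
    rewrite eqxx r_s mulr0 add0r addr0 (polar_root w_ge0 w_polar r_s r_gt0).
    by rewrite eq_sym Ps //; split=> //; rewrite ler_peMl // lerDl.
  split=> //; first by rewrite !inE hP hh eqxx orbT.
  by have := link v vP; have := ler_wpM2l sig0 hr; lra.
rewrite (bigID (fun v => hub v == v)) /=; apply: lerD.
  rewrite (eq_bigr r) => [|v /andP[_ ->]]; last exact: polar_root.
  by rewrite mulrC; apply: le_trans hub_sum _; rewrite ler_wpM2l.
rewrite mulr_sumr [leRHS](bigID (fun v => hub v == v)) /= ler_wpDl //.
  by rewrite sumr_ge0 // => v _; rewrite mulr_ge0 // addr_ge0 // ltW.
apply: ler_sum => v /andP[vP hv]; rewrite (negbTE hv).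
have [hP hc hr _] := hubP v vP.
have := polar_cell_radius (Ps _ vP) (Ps _ hP) (esym hc).
rewrite mulrC ler_pdivlMr // => h; have := link v vP; lra.
Qed.

End RandomCells.

(** * Choice of the parameters *)

Section LightTree.
Variables (R : realType) (V : finType) (w : V -> V -> R) (s : V) (r th : V -> R).
Hypothesis w_ge0 : forall u v, 0 <= w u v.
Hypothesis w_gt0 : forall u v, u != v -> 0 < w u v.
Hypothesis w_polar : forall u v, w u v ^+ 2 =
  (r u - r v) ^+ 2 + r u * r v * (2 * (1 - cos (th u - th v))).
Hypothesis r_s : r s = 0.
Hypothesis r_gt0 : forall v, v != s -> 0 < r v.
Variables (par : V -> V) (rk : V -> nat).
Hypothesis parP : forall v, v != s -> rk v = (rk (par v)).+1.

Let r_ge0 v : 0 <= r v.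
Proof. by have [->|/r_gt0/ltW//] := eqVneq v s; rewrite r_s. Qed.

Let W := \sum_(v | v != s) w (par v) v.
Let L := \sum_(v | v != s) lateral r th (par v) v.

Let W_ge0 : 0 <= W.
Proof. by apply: sumr_ge0. Qed.

Let q : R := Num.sqrt (4 * pi ^+ 2 + 1).

Let q_sqr : q ^+ 2 = 4 * pi ^+ 2 + 1.
Proof. by rewrite sqr_sqrtr // addr_ge0 // mulr_ge0 // sqr_ge0. Qed.

Let q_gt0 : 0 < q.
Proof. by rewrite sqrtr_gt0 ltr_wpDl // mulr_ge0 // sqr_ge0. Qed.

Let lateral_sqr u v :
  lateral r th u v ^+ 2 = r u * r v * (2 * (1 - cos (th u - th v))).
Proof. by rewrite sqr_sqrtr // !mulr_ge0 // subr_ge0 cos_le1. Qed.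

(** Cauchy-Schwarz: [q] is the length of the vector [(2 * pi, 1)], and [w u v] that of the pair of
    lateral and radial parts. *)
Let edge_weight_ge u v : 2 * pi * lateral r th u v + `|r u - r v| <= q * w u v.
Proof.
have a0 : 0 <= lateral r th u v by exact: sqrtr_ge0.
have p0 : 0 <= (pi : R) := pi_ge0 R.
have l0 : 0 <= 2 * pi * lateral r th u v + `|r u - r v|.
  by rewrite addr_ge0 ?mulr_ge0.
have q0 := ltW q_gt0; have qw : 0 <= q * w u v by rewrite mulr_ge0.
rewrite -ler_sqr ?nnegrE // exprMn q_sqr w_polar -lateral_sqr.
rewrite -[(r u - r v) ^+ 2]real_normK ?num_real //.
have := sqr_ge0 (lateral r th u v - 2 * pi * `|r u - r v|); lra.
Qed.

Let total_weight_ge v : 2 * pi * L + r v <= q * W.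
Proof.
have := radius_le_sum r_s parP v.
suff : 2 * pi * L + \sum_(u | u != s) `|r (par u) - r u| <= q * W by lra.
rewrite /L /W !mulr_sumr -big_split /=; apply: ler_sum => u _.
exact: edge_weight_ge.
Qed.

Let L_le_W : L <= W.
Proof.
apply: ler_sum => v _; rewrite -ler_sqr ?nnegrE ?sqrtr_ge0 //.
by rewrite lateral_sqr w_polar lerDr sqr_ge0.
Qed.

Variable d : R.
Hypothesis d_itv : 0 < d <= 1 / 100.

Let d_gt0 : 0 < d. Proof. by have /andP[] := d_itv. Qed.
Let dX_gt0 n : 0 < d ^+ n. Proof. by rewrite exprn_gt0. Qed.
Let dX_le n : d ^+ n.+1 <= d ^+ n / 100.
Proof.
rewrite exprSr ler_wpM2l //; first exact: ltW.
by have /andP[_] := d_itv; rewrite mul1r.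
Qed.

(* Hubs may lose [d * eps], which leaves [eps * (1 - 5 * d)] for the sector
   width [eta].  Annuli and spine steps have ratio [d ^+ 2]: small compared with
   [d], so that links are cheap, and with [eta ^+ 2] of order [d ^+ 16], far less
   than [d ^+ 9 * (d ^+ 2) ^+ 2], so that spine steps are nearly radial. *)
Let eps := d ^+ 8.
Let m := Num.trunc (2 * pi / (eps * (1 - 5 * d))).
Let M : R := m.+1%:R.
Let eta := 2 * pi / M.

Let c5_gt0 : 0 < eps * (1 - 5 * d).
Proof. by rewrite mulr_gt0 ?dX_gt0 //; have /andP[] := d_itv; lra. Qed.

Let M_gt0 : 0 < M. Proof. by rewrite ltr0n. Qed.

Let eta_gt0 : 0 < eta.
Proof. by rewrite divr_gt0 // mulr_gt0 // pi_gt0. Qed.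

Let trunc_itv : M - 1 <= 2 * pi / (eps * (1 - 5 * d)) < M.
Proof.
have h : 0 <= 2 * pi / (eps * (1 - 5 * d)).
  by apply: divr_ge0; [rewrite mulr_ge0 ?pi_ge0|exact: ltW].
have /andP[h1 h2] := truncn_itv h.
have E : M = m%:R + 1 by rewrite natr1.
by apply/andP; split; [rewrite E addrK|].
Qed.

Let eta_le : eta <= eps * (1 - 5 * d).
Proof.
have /andP[_] := trunc_itv; rewrite ltr_pdivrMr // => h.
by rewrite ler_pdivrMr // [leRHS]mulrC ltW.
Qed.

(** The last [eps] comes from rounding the number of sectors up; the rest is
    [1 / (1 - 5 * d) <= 1 + 10 * d]. *)
Let epsM_le : eps * M <= 2 * pi * (1 + 10 * d) + eps.
Proof.
have /andP[h _] := trunc_itv; have p0 := pi_gt0 R; have /andP[d0 d1] := d_itv.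
have c0 : 0 < 1 - 5 * d by lra.
have e0 := dX_gt0 8; rewrite -/eps in e0.
have h1 : eps * (M - 1) <= 2 * pi / (1 - 5 * d).
  have := ler_wpM2l (ltW e0) h.
  rewrite (_ : eps * (2 * pi / _) = 2 * pi / (1 - 5 * d)) //.
  by move: (pi : R) p0 => p p0; field; rewrite !gt_eqF.
have h2 : 2 * pi / (1 - 5 * d) <= 2 * pi * (1 + 10 * d).
  have : 0 <= pi * (d * (5 - 50 * d)).
    by apply: mulr_ge0; [exact: ltW|apply: mulr_ge0; lra].
  by rewrite ler_pdivrMr //; lra.
lra.
Qed.

Let eps_over_eta : eps / eta <= 1 + 11 * d.
Proof.
have p0 := pi_gt0 R; have p2 := pi_ge2 R.
rewrite (_ : eps / eta = eps * M / (2 * pi)); last first.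
  rewrite /eta; move: M M_gt0 (pi : R) p0 => N N0 p p0.
  by field; rewrite !gt_eqF.
rewrite ler_pdivrMr ?mulr_gt0 //; apply: le_trans epsM_le _.
have ed : eps <= d.
  rewrite /eps -[leRHS]expr1 -[8%N]/(7 + 1)%N exprD ler_piMl ?exprn_ile1 //.
  - by rewrite expr1 ltW.
  - exact: ltW.
  - by have /andP[] := d_itv; lra.
have : d * (2 * pi - 1) >= 0 by rewrite mulr_ge0 //; [exact: ltW|lra].
lra.
Qed.

Lemma light_tree : exists T : rel V,
  [/\ spanning_tree T, forall v, (graph_dist w T s v <= ((1 + d ^+ 8) * r v)%:E)%E
    & graph_weight w T <= (2 * pi / q + 30 * d) * (1 / d ^+ 8) * W].
Proof.
have /andP[d0 d1] := d_itv; have p0 := pi_gt0 R; have p2 := pi_ge2 R.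
have d9 : d ^+ 9 = d * eps by rewrite exprS.
have e0 : 0 < eps := dX_gt0 8.
have d2_0 := dX_gt0 2; have d2_le := dX_le 1; rewrite expr1 in d2_le.
have e2 : eps <= d ^+ 2 / 100.
  have := dX_le 2; have := dX_le 3; have := dX_le 4; have := dX_le 5.
  have := dX_le 6; have := dX_le 7; rewrite -/eps; lra.
have e3 : eps <= d * d ^+ 2.
  rewrite -exprS; have := dX_le 3; have := dX_le 4; have := dX_le 5.
  have := dX_le 6; have := dX_le 7; have := dX_gt0 3; rewrite -/eps; lra.
have tau_itv : 0 < d ^+ 9 <= 1 / 4.
  by rewrite dX_gt0 /=; have := dX_le 8; rewrite -/eps; lra.
have tau1 : 0 < d ^+ 9 <= 1 by rewrite dX_gt0 /=; have /andP[] := tau_itv; lra.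
have [P [x [sP Psum x_itv xP]]] :=
  exists_representatives w_ge0 w_polar r_s r_gt0 parP tau1.
(* Of the reserve [5 * d * eps], one part covers the hub loss, two the tree paths, and two the
   product term [2 * d * eps * eps]. *)
have eps_ge : 1 + d ^+ 9 + eta <= (1 + d ^+ 8) * (1 - 2 * d ^+ 9).
  apply: (@le_trans _ _ (1 + d ^+ 9 + eps * (1 - 5 * d))).
    by rewrite lerD2l.
  rewrite -/eps d9; have de0 : 0 < d * eps by rewrite mulr_gt0.
  have : d * eps * eps <= d * eps by rewrite ler_piMr ?ltW //; lra.
  lra.
(* The radii of the representatives sum to order [W / (d * eps)], and links cost a fraction of order
   [d ^+ 2] of that. *)
have links : eps * ((d ^+ 2 + eta) * \sum_(v in P) r v) <= 5 * d * W.
  have h1 : d ^+ 2 + eta <= 2 * d ^+ 2.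
    have : eps * (1 - 5 * d) <= eps by rewrite ler_piMr ?ltW //; lra.
    have := eta_le; lra.
  have h2 : eps * \sum_(v in P) r v <= W / d + eps * W.
    have := ler_wpM2l (ltW e0) Psum; rewrite mulrDr.
    rewrite (_ : eps * (W / d ^+ 9) = W / d) // d9.
    by field; rewrite !gt_eqF.
  have S0 : 0 <= \sum_(v in P) r v by apply: sumr_ge0.
  rewrite mulrCA; apply: le_trans (ler_wpM2r _ h1) _; first by rewrite mulr_ge0 // ltW.
  have h3 : d * (W / d) = W by rewrite mulrCA divff ?gt_eqF // mulr1.
  have h4 : 0 <= 2 * d ^+ 2 by rewrite mulr_ge0 // ltW.
  apply: le_trans (ler_wpM2l h4 h2) _.
  have -> : 2 * d ^+ 2 * (W / d + eps * W) =
      2 * d * (d * (W / d)) + 2 * d ^+ 2 * (eps * W).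
    by ring.
  rewrite h3.
  have : d ^+ 2 * (eps * W) <= d * W.
    have d2d : d ^+ 2 <= d by lra.
    have eW : eps * W <= W by rewrite ler_piMl //; lra.
    exact: (ler_pM (ltW d2_0) (mulr_ge0 (ltW e0) W_ge0) d2d eW).
  by have := mulr_ge0 (ltW d0) W_ge0; lra.
(* [X] is the main term, [L] or [2 * pi * r Rm]. The kept tree edges add [eps * W <= d * W], which
   raises 29 to 30. *)
suff [hp [Q [hpP [X cost XW]]]] : exists hp Q, [/\ (forall v, v \in P ->
    [/\ hp v != v, (hp v == s) || (hp v \in P :&: Q) &
      (1 + d ^+ 9) * r (hp v) + w (hp v) v <=
       (1 + d ^+ 9 + (if v \in Q then 0 else eta)) * r v]) &
    exists2 X, eps * \sum_(v in P) w (hp v) v <= X + 29 * d * W & X <= 2 * pi / q * W].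
  have [T [T1 T2 T3]] := assemble_tree w_ge0 w_polar r_s r_gt0 parP tau_itv
    (ltW (dX_gt0 9)) (ltW eta_gt0) sP x_itv xP hpP eps_ge w_gt0.
  exists T; split=> //; apply: le_trans T3 _.
  rewrite div1r [leRHS]mulrAC -/eps ler_pdivlMr // -/W.
  have eW : eps * W <= d * W by rewrite ler_wpM2r //; lra.
  move: (2 * pi / q) XW (\sum_(v in P) _) cost eW => c XW S cost eW.
  lra.
have [Rm Rm_max] : exists Rm, forall v, r v <= r Rm.
  by case: (@arg_maxP _ _ _ s xpredT r isT) => v _ h; exists v => u; exact: h.
have RmW : r Rm <= W := radius_le_weight w_ge0 w_polar r_s r_gt0 parP Rm.
have tw := total_weight_ge Rm.
have kap_itv : 0 < d ^+ 2 <= 1 / 2 by rewrite d2_0 /=; lra.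
have [LR|/ltW RL] := leP L (2 * pi * r Rm).
  have [hp [Q [hpP cost]]] :=
    cell_spokes w_ge0 w_polar r_s r_gt0 parP m kap_itv sP (ltW (dX_gt0 9)).
  exists hp, Q; split=> //; exists L; last first.
    (* Here [q ^+ 2 * L = 2 * pi * (2 * pi * L) + L], which is at most [2 * pi * (2 * pi * L + r Rm)
       <= 2 * pi * (q * W)]. *)
    rewrite -(ler_pM2l q_gt0) mulrA mulrCA divff ?gt_eqF // mulr1.
    rewrite -(ler_pM2l q_gt0) mulrA -expr2 q_sqr.
    have : 2 * pi * (2 * pi * L + r Rm) <= 2 * pi * (q * W).
      by rewrite ler_wpM2l ?mulr_ge0 ?(ltW p0).
    lra.
  have L0 : 0 <= L by apply: sumr_ge0 => v _; exact: sqrtr_ge0.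
  set k := d ^+ 2 in cost links kap_itv d2_0 d2_le e2 e3 *.
  have ki : (1 - k)^-1 <= 1 + d.
    rewrite -[leLHS]mul1r ler_pdivrMr; last by lra.
    have kd : k * d <= k by apply: ler_piMr; [exact: ltW|lra].
    lra.
  have ki0 : 0 <= (1 - k)^-1 by rewrite invr_ge0; lra.
  apply: le_trans (ler_wpM2l (ltW e0) cost) _; rewrite mulrDr.
  have e1 : eps * ((3 * W / k + 2 * W + L / (1 - k) / eta) / (1 - k)) =
     (1 - k)^-1 * (3 * W * (eps / k) + 2 * W * eps) +
     (1 - k)^-1 * (1 - k)^-1 * (eps / eta) * L by ring.
  rewrite -/W -/L -/eta e1.
  have ek : eps / k <= d by rewrite ler_pdivrMr.
  have {}e1 : (1 - k)^-1 * (3 * W * (eps / k) + 2 * W * eps) <= (1 + d) * (5 * d * W).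
    have ek0 : 0 <= eps / k by apply: divr_ge0; exact: ltW.
    have a1 := mulr_ge0 W_ge0 ek0; have a2 := mulr_ge0 W_ge0 (ltW e0).
    apply: ler_pM => //; first by lra.
    have : W * (eps / k) <= W * d by rewrite ler_wpM2l.
    have : W * eps <= W * d by apply: ler_wpM2l => //; lra.
    lra.
  have B1 : (1 - k)^-1 * (1 - k)^-1 * (eps / eta) <= (1 + d) * (1 + d) * (1 + 11 * d).
    have ee0 : 0 <= eps / eta by apply: divr_ge0; exact: ltW.
    apply: ler_pM => //; first by rewrite mulr_ge0.
    exact: ler_pM.
  (* With [L <= W], the errors [15 * d * W], [(1 + d) * (5 * d * W)] and [5 * d * W] from [links]
     stay below [29 * d * W]. *)
  have B2 : (1 + d) * (1 + d) * (1 + 11 * d) <= 1 + 15 * d.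
    have dd : d * d <= d / 100 by rewrite -{3}[d]mulr1 -mulrA ler_wpM2l ?(ltW d0) //; lra.
    have : d * d * d <= d * d by rewrite ler_piMr ?mulr_ge0 ?(ltW d0) //; lra.
    lra.
  have := ler_wpM2r L0 (le_trans B1 B2) => B3.
  have dL : d * L <= d * W by rewrite ler_wpM2l ?(ltW d0).
  have ddW : d * (d * W) <= (d * W) / 100.
    by have := ler_wpM2r (mulr_ge0 (ltW d0) W_ge0) d1; lra.
  have dW0 := mulr_ge0 (ltW d0) W_ge0.
  lra.
have mu0 := ltW d2_0; have sig0 := ltW (dX_gt0 9).
have hop_ok : eta ^+ 2 * (1 + d ^+ 2) ^+ 2 <= 2 * d ^+ 9 * (d ^+ 2) ^+ 2.
  have h1 : eta ^+ 2 <= eps * d ^+ 5.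
    have ee : eta <= eps.
      by apply: le_trans eta_le _; rewrite ler_piMr ?(ltW e0) //; lra.
    rewrite expr2; apply: ler_pM => //; try exact: ltW.
    by apply: le_trans ee _; have := dX_le 5; have := dX_le 6; have := dX_le 7;
      have := dX_gt0 5; rewrite -/eps; lra.
  have h2 : (1 + d ^+ 2) ^+ 2 <= 2.
    have : d ^+ 2 * d ^+ 2 <= d ^+ 2 by rewrite ler_piMr //; lra.
    lra.
  apply: le_trans (ler_pM (sqr_ge0 _) (sqr_ge0 _) h1 h2) _.
  rewrite (_ : 2 * d ^+ 9 * (d ^+ 2) ^+ 2 = eps * d ^+ 5 * 2) //.
  by rewrite /eps; ring.
have [hp [Q [hpP cost]]] := spines w_ge0 w_polar r_s r_gt0 (ltW eta_gt0) mu0 sig0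
  hop_ok Rm_max sP (erefl eta).
exists hp, Q; split=> //; exists (2 * pi * r Rm); last first.
  (* Here [q ^+ 2 * r Rm = 2 * pi * (2 * pi * r Rm) + r Rm <= 2 * pi * L + r Rm <= q * W]. *)
  have qR : q * r Rm <= W.
    rewrite -(ler_pM2l q_gt0) mulrA -expr2 q_sqr.
    have := ler_wpM2l (_ : 0 <= 2 * pi) RL; rewrite mulr_ge0 ?(ltW p0) // => /(_ isT).
    lra.
  rewrite -(ler_pM2l q_gt0) [leRHS]mulrA [q * (_ / _)]mulrC divfK ?gt_eqF //.
  have := ler_wpM2l (_ : 0 <= 2 * pi) qR; rewrite mulr_ge0 ?(ltW p0) // => /(_ isT).
  lra.
have rR := r_ge0 Rm.
apply: le_trans (ler_wpM2l (ltW e0) cost) _; rewrite mulrDr -/M.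
(* This turns the relative errors of the main term into multiples of [d * W]. *)
have piR : 2 * pi * r Rm <= W := le_trans RL L_le_W.
have s1 : 1 + d ^+ 9 <= 1 + d by have := dX_le 8; rewrite -/eps; lra.
have : eps * (M * ((1 + d ^+ 9) * r Rm)) <=
    (2 * pi * (1 + 10 * d) + d) * ((1 + d) * r Rm).
  rewrite mulrA; apply: ler_pM.
  - by rewrite mulr_ge0 // ltW.
  - by rewrite mulr_ge0 // addr_ge0.
  - by apply: le_trans epsM_le _; rewrite lerD2l; lra.
  by rewrite ler_wpM2r.
have dpi := ler_wpM2l (ltW d0) piR.
have dR := ler_wpM2l (ltW d0) RmW.
have dW0 := mulr_ge0 (ltW d0) W_ge0.
have ddpi : d * (d * (2 * pi * r Rm)) <= d * W / 100.
  have := ler_wpM2l (ltW d0) dpi.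
  by have := ler_wpM2r dW0 d1; lra.
have ddR : d * (d * r Rm) <= d * W / 100.
  have := ler_wpM2l (ltW d0) dR.
  by have := ler_wpM2r dW0 d1; lra.
lra.
Qed.

End LightTree.

(** * The Euclidean plane *)

(** The angle is the arc cosine of [x / n], negated when [y < 0]; at the origin any angle works. *)
Lemma polar_coordinates (R : realType) (x y : R) : exists t,
  x = Num.sqrt (x ^+ 2 + y ^+ 2) * cos t /\ y = Num.sqrt (x ^+ 2 + y ^+ 2) * sin t.
Proof.
set n := Num.sqrt _.
have n2 : n ^+ 2 = x ^+ 2 + y ^+ 2 by rewrite sqr_sqrtr // addr_ge0 ?sqr_ge0.
have n0 : 0 <= n by exact: sqrtr_ge0.
have x2 := sqr_ge0 x; have y2 := sqr_ge0 y.
have [nE|nn] := eqVneq n 0.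
  exists 0; rewrite nE !mul0r; move: n2; rewrite nE expr0n /= => n2.
  by split; apply/eqP; rewrite -sqrf_eq0 eq_le ?x2 ?y2 andbT; lra.
have np : 0 < n by rewrite lt_neqAle eq_sym nn.
have xn : -1 <= x / n <= 1.
  rewrite -ler_norml normrM normfV (ger0_norm n0) ler_pdivrMr // mul1r.
  by rewrite -ler_sqr ?nnegrE // real_normK ?num_real // n2 lerDl.
have sE : n * sin (acos (x / n)) = `|y|.
  rewrite sin_acos // -{1}(ger0_norm n0) -sqrtr_sqr -sqrtrM ?sqr_ge0 //.
  rewrite -[RHS]sqrtr_sqr; congr Num.sqrt.
  rewrite mulrBr mulr1 exprMn exprVn mulrCA divff ?expf_neq0 // mulr1 n2.
  by rewrite addrAC subrr add0r.
have cE : n * cos (acos (x / n)) = x by rewrite acosK // mulrC divfK.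
have [y0|y0] := leP 0 y.
  by exists (acos (x / n)); rewrite cE sE ger0_norm.
by exists (- acos (x / n)); rewrite cosN sinN mulrN cE sE ltr0_norm // opprK.
Qed.

Section Plane.
Variables (R : realType) (S : {fset 'rV[R]_2}) (s : S).

Let w := euclidean_weight S.

Let dx (v : S) : R := val v 0 0 - val s 0 0.
Let dy (v : S) : R := val v 0 1 - val s 0 1.

Let w_sqr u v : w u v ^+ 2 = (dx u - dx v) ^+ 2 + (dy u - dy v) ^+ 2.
Proof.
rewrite /w /euclidean_weight /edist sqr_sqrtr; last first.
  by apply: sumr_ge0 => i _; exact: sqr_ge0.
rewrite !big_ord_recl big_ord0 addr0 /dx /dy.
by rewrite (_ : lift _ _ = 1); [ring|exact: val_inj].
Qed.

Lemma euclidean_weight_gt0 u v : u != v -> 0 < w u v.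
Proof.
move=> uv; rewrite lt_neqAle sqrtr_ge0 andbT eq_sym; apply: contra uv => /eqP w0.
have := w_sqr u v; rewrite w0 expr0n /= => /esym/eqP.
rewrite paddr_eq0 ?sqr_ge0 // !sqrf_eq0 /dx /dy => /andP[/eqP hx /eqP hy].
apply/eqP/val_inj/rowP => i; case: (unliftP 0 i) => [j|] ->.
  by rewrite ord1 (_ : lift _ _ = 1); [lra|exact: val_inj].
lra.
Qed.

(** The law of cosines in the triangle with vertices [s], [u], [v], with the squared difference of
    the radii split off. *)
Lemma euclidean_weight_polar : exists th : S -> R, forall u v,
  w u v ^+ 2 = (w s u - w s v) ^+ 2 + w s u * w s v * (2 * (1 - cos (th u - th v))).
Proof.
have wE v : w s v = Num.sqrt (dx v ^+ 2 + dy v ^+ 2).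
  rewrite -[LHS]ger0_norm ?sqrtr_ge0 // -sqrtr_sqr w_sqr; congr Num.sqrt.
  by rewrite /dx /dy !subrr !sub0r !sqrrN.
have /choice[th thP] v := polar_coordinates (dx v) (dy v).
exists th => u v; have [xu yu] := thP u; have [xv yv] := thP v.
rewrite -!wE in xu yu xv yv; rewrite w_sqr xu yu xv yv cosB.
have cu := cos2Dsin2 (th u); have cv := cos2Dsin2 (th v).
have -> : (w s u - w s v) ^+ 2 = w s u ^+ 2 * (cos (th u) ^+ 2 + sin (th u) ^+ 2)
    + w s v ^+ 2 * (cos (th v) ^+ 2 + sin (th v) ^+ 2) - 2 * (w s u * w s v).
  by rewrite cu cv; ring.
ring.
Qed.

Lemma euclidean_SLT (d : R) : 0 < d <= 1 / 100 -> exists T : rel S,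
  is_SLT w s (1 + d ^+ 8)
    ((2 * pi / Num.sqrt (4 * pi ^+ 2 + 1) + 30 * d) * (1 / d ^+ 8)) T.
Proof.
move=> d_itv; have /andP[d0 d1] := d_itv.
have w_ge0 u v : 0 <= w u v by exact: sqrtr_ge0.
have [th w_polar] := euclidean_weight_polar.
have w_ss : w s s = 0.
  by apply/eqP; rewrite -sqrf_eq0 w_sqr !subrr expr0n addr0.
have w_s v : v != s -> 0 < w s v by rewrite eq_sym; exact: euclidean_weight_gt0.
have [M MM] := MST_exists w_s.
have [[Msym _] Mcon _] := MM.1.
have [par [rk parP]] := bfs_parent s Mcon.
have w_sym := polar_sym w_ge0 w_polar.
have parM := parent_weight_le w_sym w_ge0 Msym parP.
have rkP v : v != s -> rk v = (rk (par v)).+1 by move=> /parP[].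
have [T [T1 T2 T3]] := light_tree w_ge0 euclidean_weight_gt0 w_polar w_ss w_s rkP d_itv.
have b0 : 0 <= 2 * pi / Num.sqrt (4 * pi ^+ 2 + 1) :> R.
  by rewrite divr_ge0 ?mulr_ge0 ?pi_ge0 ?sqrtr_ge0.
have d8 : 0 < d ^+ 8 by rewrite exprn_gt0.
have d8d : d ^+ 8 <= d.
  by rewrite -[leRHS]expr1 -[8%N]/(1 + 7)%N exprD ler_piMr ?exprn_ile1 ?expr1 //; lra.
exists T; split=> //.
- by rewrite lerDl ltW.
(* The term [30 * d] alone exceeds [d ^+ 8], so the lightness factor is at least 1. *)
- by rewrite div1r ler_pdivlMr // mul1r; lra.
exists M; split=> //; apply: le_trans T3 _; apply: ler_wpM2l => //.
by rewrite mulr_ge0 ?divr_ge0 ?addr_ge0 ?mulr_ge0 ?pi_ge0 ?sqrtr_ge0 // ltW.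
Qed.

End Plane.

Theorem theorem1p2 (R : realType) :
  exists (eps0 : R) (eta : R -> R),
    [/\ 0 < eps0,
        forall eps : R, 0 < eps <= eps0 -> 0 <= eta eps,
        eta eps @[eps --> 0^'+] --> (0 : R)
      & forall (S : {fset 'rV[R]_2}) (s : S) (eps : R), 0 < eps <= eps0 ->
          exists T : rel S,
            is_SLT (euclidean_weight S) s (1 + eps)
              ((2 * pi / Num.sqrt (4 * pi ^+ 2 + 1) + eta eps) * (1 / eps)) T].
Proof.
pose root8 (x : R) := Num.sqrt (Num.sqrt (Num.sqrt x)).
have root8K x : 0 <= x -> root8 x ^+ 8 = x.
  by move=> x0; rewrite -[8%N]/(2 * (2 * 2))%N !exprM !sqr_sqrtr ?sqrtr_ge0.
(* Take [d = root8 eps]; the bound on [eps] says that [d <= 1 / 100]. *)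
exists ((1 / 100) ^+ 8), (fun eps => 30 * root8 eps); split.
- by rewrite exprn_gt0.
- by move=> eps _; rewrite mulr_ge0 ?sqrtr_ge0.
- have c : continuous (fun eps : R => 30 * root8 eps).
    move=> x; apply: cvgM; first exact: cvg_cst.
    apply: continuous_comp; first apply: continuous_comp; exact: sqrt_continuous.
  have := cvg_at_right_filter (c 0).
  by rewrite /root8 !sqrtr0 mulr0.
move=> S s eps /andP[e0 e1].
have r0 : 0 < root8 eps by rewrite !sqrtr_gt0.
have rE := root8K _ (ltW e0).
have r1 : root8 eps <= 1 / 100.
  by rewrite -(@ler_pXn2r _ 8) ?nnegrE ?rE // ltW.
have r_itv : 0 < root8 eps <= 1 / 100 by rewrite r0.
by have := euclidean_SLT s r_itv; rewrite rE.
Qed.
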